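(* Let $d\ge 1$, $n\ge1$, let $\mathbb P_n=\frac1n\sum_{i=1}^n\delta_{\{\mathbf x_i\}}$ be the empirical law of points $\mathbf x_1,\dots,\mathbf x_n\in\mathbb R^d$. For any $\delta\ge0$ and any $0<\alpha\le\alpha^*(\delta,\mathbb P_n)$ it holds that $$BP(U_\delta(\alpha),\mathbb P_n)=\frac{\lceil n\alpha/(1-\alpha)\rceil}{n+\lceil n\alpha/(1-\alpha)\rceil}.$$ Moreover, if $\mathbb P_n$, $n\ge1$, are the empirical laws of the first $n$ terms of an i.i.d. sequence with law $\mathbb P$ on $\mathbb R^d$, then for $\delta\ge0$ and $0<\alpha<\alpha^*(\delta,\mathbb P)$ we have $BP(U_\delta(\alpha),\mathbb P_n)\to\alpha$ as $n\to\infty$, almost surely.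
   Context: $\delta_{\{\mathbf x\}}$ is the Dirac mass at $\mathbf x$, $\|\cdot\|$ the Euclidean norm. For laws $\mathbb Q,\mathbb Q'$ on $\mathbb R^d$ the Wasserstein distance is $d_W(\mathbb Q,\mathbb Q')=\inf_\Pi\int\|\mathbf x-\mathbf y\|\,\Pi(\mathrm d\mathbf x,\mathrm d\mathbf y)\in[0,\infty]$, over all joint laws $\Pi$ with marginals $\mathbb Q,\mathbb Q'$. The robustified halfspace depth for $\delta\ge0$ is $$D_\delta(\mathbf z|\mathbb Q)=\inf_{\|\mathbf u\|=1}\ \sup_{\mathbb Q':d_W(\mathbb Q',\mathbb Q)\le\delta}\mathbb Q'(\{\mathbf x:\langle\mathbf u,\mathbf x-\mathbf z\rangle\ge0\})$$ (for $\delta=0$ this is the classical halfspace depth $\inf_{\|\mathbf u\|=1}\mathbb Q(\{\mathbf x:\langle\mathbf u,\mathbf x-\mathbf z\rangle\ge0\})$). Maximal depth: $\overline\alpha(\delta,\mathbb Q)=\sup_{\mathbf z\in\mathbb R^d}D_\delta(\mathbf z|\mathbb Q)$ (the supremum is attained). The number $\alpha^*=\alpha^*(\delta,\mathbb Q)\in(0,1/2]$ is the unique solution in $(0,1)$ of $$\frac{\alpha^*}{1-\alpha^*}=\overline\alpha\Big(\frac{\delta}{1-\alpha^*},\mathbb Q\Big).$$ Upper level set: $U_\delta(\alpha|\mathbb Q)=\{\mathbf z\in\mathbb R^d:D_\delta(\mathbf z|\mathbb Q)\ge\alpha\}$. $d_H(A,B)$ is the Hausdorff distance between compact sets, with $d_H(A,B)=\infty$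 if $A$ or $B$ is empty. The breakdown point is $$BP(U_\delta(\alpha),\mathbb P_n)=\min_{m\in\mathbb N}\Big\{\frac m{m+n}:\sup_{\mathbf y_1,\dots,\mathbf y_m\in\mathbb R^d}d_H(U_\delta(\alpha|\mathbb P_n),U_\delta(\alpha|\mathbb P_{n+m}))=\infty\Big\},$$ where $\mathbb P_{n+m}=\frac1{n+m}\big(\sum_{i=1}^n\delta_{\{\mathbf x_i\}}+\sum_{i=1}^m\delta_{\{\mathbf y_i\}}\big)$. *)

(* Defs.v *)
From HB Require Import structures.
From mathcomp Require Import all_boot all_order all_algebra.
From mathcomp Require Import all_classical all_reals all_analysis.

Set Implicit Arguments.
Unset Strict Implicit.
Unset Printing Implicit Defensive.

Import Order.TTheory GRing.Theory Num.Theory.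
Import numFieldNormedType.Exports.

Local Open Scope classical_set_scope.
Local Open Scope ring_scope.

(* The space R^d with its Borel sigma-algebra; the norm that the library puts
   on 'rV[R]_d is the max norm (same topology, hence same Borel sets), so the
   Euclidean norm is defined separately below. *)
Notation borelRd R d := (g_sigma_algebraType (@open 'rV[R%type]_d)).

Section euclidean.
Context {R : realType} {d : nat}.
Implicit Types u x z : 'rV[R]_d.

Definition dotp u x : R := \sum_(i < d) u ord0 i * x ord0 i.

Definition enorm x : R := Num.sqrt (dotp x x).

Definition halfspace u z : set 'rV[R]_d := [set x | 0 <= dotp u (x - z)].

(* Intended for compact A and B; infinite by convention if A or B is empty. *)
Definition hausdorff_dist (A B : set 'rV[R]_d) : \bar R :=
  if `[< A = set0 \/ B = set0 >] then +oo%E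
  else maxe
    (ereal_sup [set ereal_inf [set (enorm (a - b))%:E | b in B] | a in A])
    (ereal_sup [set ereal_inf [set (enorm (a - b))%:E | a in A] | b in B]).

End euclidean.

Section depth.
Context {R : realType} {d : nat}.
Local Notation V := (borelRd R d).
Implicit Types (Q : probability V R) (delta alpha : R) (z : 'rV[R]_d).

Definition coupling Q Q' : set (probability (V * V)%type R) :=
  [set Pi | forall A : set V, measurable A ->
     Pi (fst @^-1` A) = Q A /\ Pi (snd @^-1` A) = Q' A].

Definition wasserstein Q Q' : \bar R :=
  ereal_inf [set (\int[Pi]_p (enorm ((p.1 : 'rV[R]_d) - p.2))%:E)%E
            | Pi in coupling Q Q'].

Definition depth delta Q z : \bar R :=
  ereal_inf [set
    ereal_sup [set (Q' : probability V R) (halfspace u z)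
              | Q' in [set Q' | (wasserstein Q' Q <= delta%:E)%E]]
    | u in [set u : 'rV[R]_d | enorm u = 1]].

Definition max_depth delta Q : \bar R := ereal_sup (range (depth delta Q)).

(* For d >= 1 and delta >= 0 the solution in (0, 1) exists and is unique; the
   default value 0 is then never used. *)
Definition alpha_star delta Q : R :=
  xget 0 [set a | 0 < a < 1 /\
                  (a / (1 - a))%:E = max_depth (delta / (1 - a)) Q].

Definition upper_level delta alpha Q : set 'rV[R]_d :=
  [set z | (alpha%:E <= depth delta Q z)%E].

End depth.

Section empirical.
Context {R : realType} {d : nat}.
Local Notation V := (borelRd R d).

Definition empirical n (n0 : (0 < n)%N) (x : 'I_n -> 'rV[R]_d) (A : set V)
    : \bar R :=
  ((n%:R^-1)%:E * \sum_(i < n) \d_(x i : V) A)%E.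

Section instances.
Context n (n0 : (0 < n)%N) (x : 'I_n -> 'rV[R]_d).

Let invn_ge0 : 0 <= n%:R^-1 :> R. Proof. by rewrite invr_ge0 ler0n. Qed.

Let empiricalE : empirical n0 x =
  mscale (NngNum invn_ge0)
    (msum (fun k => \d_(oapp x point (insub k) : V)) n).
Proof.
apply/funext => A; rewrite /empirical /mscale /msum /=; congr (_ * _)%E.
by apply: eq_bigr => i _; rewrite valK.
Qed.

Let empirical0 : empirical n0 x set0 = 0%E.
Proof. by rewrite empiricalE measure0. Qed.

Let empirical_ge0 A : (0 <= empirical n0 x A)%E.
Proof. by rewrite empiricalE. Qed.

Let empirical_sigma_additive : semi_sigma_additive (empirical n0 x).
Proof. by rewrite empiricalE; exact: measure_semi_sigma_additive. Qed.

HB.instance Definition _ := isMeasure.Build _ _ _ (empirical n0 x)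
  empirical0 empirical_ge0 empirical_sigma_additive.

Let empiricalT : empirical n0 x setT = 1%E.
Proof.
rewrite /empirical (eq_bigr (fun=> 1%E)); last by move=> i _; rewrite diracT.
rewrite sumEFin sumr_const card_ord -EFinM mulVf//.
by rewrite pnatr_eq0 -lt0n.
Qed.

HB.instance Definition _ :=
  Measure_isProbability.Build _ _ _ (empirical n0 x) empiricalT.

End instances.

Definition pooled n m (x : 'I_n -> 'rV[R]_d) (y : 'I_m -> 'rV[R]_d)
    (i : 'I_(n + m)) : 'rV[R]_d :=
  match fintype.split i with inl j => x j | inr k => y k end.

(* As m / (m + n) increases with m, the infimum is a minimum whenever some m
   causes breakdown, and it is +oo otherwise. *)
Definition breakdown_point (delta alpha : R) n (n0 : (0 < n)%N)
    (x : 'I_n -> 'rV[R]_d) : \bar R :=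
  ereal_inf [set (m%:R / (m + n)%:R)%:E | m in [set m : nat |
    ereal_sup (range (fun y : 'I_m -> 'rV[R]_d =>
      hausdorff_dist (upper_level delta alpha (empirical n0 x))
        (upper_level delta alpha
          (empirical (ltn_addr m n0) (pooled x y))))) = +oo%E]].

End empirical.

Section iid.
Context {R : realType} {dO dV : measure_display} {Omega : measurableType dO}
  {V : measurableType dV}.

Definition iid (Pr : probability Omega R) (P : probability V R)
    (X : nat -> {mfun Omega >-> V}) : Prop :=
  (forall i (A : set V), measurable A -> Pr (X i @^-1` A) = P A) /\
  (forall (s : seq nat) (A : nat -> set V), uniq s ->
     (forall i, measurable (A i)) ->
     Pr (\bigcap_(i in [set` s]) (X i @^-1` A i)) =
     (\prod_(i <- s) Pr (X i @^-1` A i))%E).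

End iid.

(* Main.v *)
(** Linear programming duality turns the depth of an empirical law into an
elementary formula: with [gap u z x = max 0 <u, z - x>], the distance from [x]
to the halfspace [H(u,z)], one has [a <= D_delta(z|P_n)] iff
[a <= l * delta + 1/n \sum_i max 0 (1 - l * gap u z x_i)] for every unit [u]
and every [l > 0].  The upper bound integrates
[1_H(x) <= l |x - y| + max 0 (1 - l * gap y)] against a coupling; equality is
reached by moving the nearest sample points onto [H] until the budget [delta]
is spent.

Adding [m] points multiplies the sum over the old points by [n/(n+m)], so with
[s = 1 - alpha*] the dual formula at [(delta, P_{n+m})] dominates [s] times
the one at [(delta/s, P_n)] whenever [m/(n+m) < alpha], which keeps the level
set nonempty; it stays bounded because the new points contribute less than
[alpha].  If [m/(n+m) >= alpha], putting all new points at one remote location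
makes that location deep.

For i.i.d. samples the same formula shows that [D_delta(z|P_n)] is, up to [e],
at least [D_delta(z|P)] as soon as [P H <= P_n H + e] for all halfspaces [H].
This one-sided uniform law of large numbers holds because halfspaces have
finitely many inner brackets, by induction on the dimension: near a direction
[v0], the sets [{x | 0 <= <v,x>}] vary only on a thin slab around the
hyperplane [<v0,x> = 0], and on the hyperplane itself the dimension drops. *)

Require Import Defs.
From HB Require Import structures.
From mathcomp Require Import all_boot all_order all_algebra.
From mathcomp Require Import all_classical all_reals all_analysis.
From mathcomp Require Import measurable_realfun.
From mathcomp Require Import ring lra.

Set Implicit Arguments.
Unset Strict Implicit.
Unset Printing Implicit Defensive.

Import Order.TTheory GRing.Theory Num.Theory.
Import numFieldNormedType.Exports.

Local Open Scope classical_set_scope.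
Local Open Scope ring_scope.

(** * Euclidean vectors and Borel sets *)

Section euclidean_lemmas.
Context {R : realType} {d : nat}.
Implicit Types (u v x y z : 'rV[R]_d) (a : R).

Lemma dotpC u x : dotp u x = dotp x u.
Proof. by apply: eq_bigr => i _; rewrite mulrC. Qed.

Lemma dotpDr u x y : dotp u (x + y) = dotp u x + dotp u y.
Proof. by rewrite -big_split; apply: eq_bigr => i _; rewrite mxE mulrDr. Qed.

Lemma dotpZr u a x : dotp u (a *: x) = a * dotp u x.
Proof. by rewrite mulr_sumr; apply: eq_bigr => i _; rewrite mxE mulrCA. Qed.

Lemma dotpNr u x : dotp u (- x) = - dotp u x.
Proof. by rewrite -scaleN1r dotpZr mulN1r. Qed.

Lemma dotpBr u x y : dotp u (x - y) = dotp u x - dotp u y.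
Proof. by rewrite dotpDr dotpNr. Qed.

Lemma dotpZl u a x : dotp (a *: u) x = a * dotp u x.
Proof. by rewrite dotpC dotpZr dotpC. Qed.

Lemma dotpNl u x : dotp (- u) x = - dotp u x.
Proof. by rewrite dotpC dotpNr dotpC. Qed.

Lemma dotpBl u v x : dotp (u - v) x = dotp u x - dotp v x.
Proof. by rewrite dotpC dotpBr !(dotpC x). Qed.

Lemma dotpp_ge0 x : 0 <= dotp x x.
Proof. by apply: sumr_ge0 => i _; rewrite -expr2 sqr_ge0. Qed.

Lemma dotpp_eq0 x : dotp x x = 0 -> x = 0.
Proof.
move=> /psumr_eq0P x0; apply/rowP => i; apply/eqP; rewrite mxE -sqrf_eq0 expr2.
by rewrite x0// => j _; rewrite -expr2 sqr_ge0.
Qed.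

Lemma enorm_ge0 x : 0 <= enorm x.
Proof. exact: sqrtr_ge0. Qed.

Lemma enorm_sqr x : enorm x ^+ 2 = dotp x x.
Proof. by rewrite sqr_sqrtr// dotpp_ge0. Qed.

Lemma enorm1 u : enorm u = 1 -> dotp u u = 1.
Proof. by move=> u1; rewrite -enorm_sqr u1 expr1n. Qed.

Lemma enormN x : enorm (- x) = enorm x.
Proof. by rewrite /enorm dotpNl dotpNr opprK. Qed.

Lemma enormZ_ge0 a u : enorm u = 1 -> 0 <= a -> enorm (a *: u) = a.
Proof.
by move=> u1 a0; rewrite /enorm dotpZl dotpZr enorm1// mulr1 -expr2 sqrtr_sqr
  ger0_norm.
Qed.

Lemma dotp_le_enorm u x : enorm u = 1 -> dotp u x <= enorm x.
Proof.
move=> /enorm1 u1; have [ux0|ux0] := leP (dotp u x) 0.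
  by rewrite (le_trans ux0)// enorm_ge0.
rewrite -ler_sqr ?nnegrE ?enorm_ge0 ?(ltW ux0)// enorm_sqr.
have := dotpp_ge0 (x - dotp u x *: u).
by rewrite !(dotpBr, dotpBl) !(dotpZr, dotpZl) u1 (dotpC x u) expr2; lra.
Qed.

Lemma enorm_unit x : x != 0 ->
  exists u, enorm u = 1 /\ dotp u x = enorm x.
Proof.
move=> x0; have nx0 : enorm x != 0.
  apply: contra x0 => /eqP nx0; apply/eqP/dotpp_eq0.
  by rewrite -enorm_sqr nx0 expr0n.
exists ((enorm x)^-1 *: x); rewrite dotpZl -enorm_sqr expr2 mulKf//; split=> //.
rewrite /enorm dotpZl dotpZr -/(enorm x) -enorm_sqr expr2 mulKf// mulVf//.
by rewrite sqrtr1.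
Qed.

Lemma enorm_delta (i : 'I_d) : enorm (delta_mx 0 i : 'rV[R]_d) = 1.
Proof.
rewrite /enorm /dotp (bigD1 i)//= big1 ?addr0 => [|j ji].
  by rewrite mxE !eqxx mulr1 sqrtr1.
by rewrite mxE (negPf ji) andbF mul0r.
Qed.

Lemma dotp_delta (i : 'I_d) x : dotp (delta_mx 0 i) x = x 0 i.
Proof.
rewrite /dotp (bigD1 i)//= big1 ?addr0 => [|j ji].
  by rewrite mxE !eqxx mul1r.
by rewrite mxE (negPf ji) andbF mul0r.
Qed.

(** Pulling the base point back by [a >= 0] along [u] thickens the halfspace by the distance [a];
    the staircase used in weak duality is built from such thickenings. *)
Lemma halfspace_shiftE u z a x : enorm u = 1 ->
  halfspace u (z - a *: u) x <-> - a <= dotp u (x - z).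
Proof.
move=> /enorm1 u1; rewrite /halfspace/= opprB addrCA (dotpDr u (a *: u)) dotpZr u1.
by rewrite mulr1 -lerBlDl sub0r.
Qed.

End euclidean_lemmas.

Section borel_vectors.
Context {R : realType} {d : nat}.
Local Notation V := (borelRd R d).

Lemma measurable_coord (i : 'I_d) :
  measurable_fun [set: V] (fun x : V => (x : 'rV[R]_d) 0 i).
Proof.
apply: (measurability _ (RGenOpens.measurableE R)).
move=> _ [_ [a [b ->] <-]]; rewrite setTI; apply: sub_sigma_algebra.
have /continuousP := @coord_continuous R 1 d 0 i; apply.
exact: interval_open.
Qed.

Lemma measurable_dotp d' (T : measurableType d') (u : 'rV[R]_d)
    (f : T -> 'rV[R]_d) :
  (forall i, measurable_fun setT (fun x => f x 0 i)) ->
  measurable_fun setT (fun x => dotp u (f x)).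
Proof.
by move=> mf; apply: measurable_sum => i; apply: measurable_funM.
Qed.

Lemma measurable_halfspace (u z : 'rV[R]_d) :
  measurable (halfspace u z : set V).
Proof.
have mf : measurable_fun [set: V] (fun x : V => dotp u ((x : 'rV[R]_d) - z)).
  apply: measurable_dotp => i.
  apply: (@eq_measurable_fun _ _ _ _ _ (fun x : V => (x : 'rV[R]_d) 0 i - z 0 i)).
    by move=> x _; rewrite !mxE.
  by apply: measurable_funB => //; exact: measurable_coord.
have := mf measurableT _ (measurable_itv `[0, +oo[).
rewrite setTI; congr measurable.
by apply/seteqP; split => x; rewrite /halfspace/= in_itv/= andbT.
Qed.

Lemma measurable_enormB :
  measurable_fun [set: V * V] (fun p => enorm ((p.1 : 'rV[R]_d) - p.2)).
Proof.
apply: measurableT_comp.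
  by apply: continuous_measurable_fun; exact: sqrt_continuous.
apply: measurable_sum => i; apply: measurable_funM;
  apply: (@eq_measurable_fun _ _ _ _ _
    (fun p : V * V => (p.1 : 'rV[R]_d) 0 i - (p.2 : 'rV[R]_d) 0 i));
  try by [move=> x _; rewrite !mxE];
  by apply: measurable_funB;
    (apply: (measurableT_comp (measurable_coord i));
      [exact: measurable_fst || exact: measurable_snd]).
Qed.

End borel_vectors.

(** * Duality for the depth *)

Section counting.
Context {R : realType}.
Implicit Types w y : R.

Lemma count_ge w (K : nat) : 0 <= w ->
  K%:R - w <= \sum_(j < K) (w <= j.+1%:R)%R%:R.
Proof.
move=> w0; elim: K => [|K ih]; first by rewrite big_ord0; lra.
rewrite big_ord_recr/=; have [wK|wK] := leP w K.+1%:R.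
  by rewrite -natr1 addrAC lerD2r.
by rewrite addr0 (le_trans (y:=0)) ?sumr_ge0// subr_le0 ltW.
Qed.

Lemma count_le w (K : nat) :
  \sum_(j < K) (w <= j.+1%:R)%R%:R <= Num.max 0 (K%:R - w) + 1 :> R.
Proof.
(* This sharper bound survives the induction: it remembers that the count is still 0 while [w]
   exceeds [K]. *)
suff : \sum_(j < K) (w <= j.+1%:R)%R%:R <= (if w <= K%:R then K%:R - w + 1 else 0) :> R.
  move=> /le_trans; apply; case: (leP w) => wK; case: (leP 0 (K%:R - w)) => ?; lra.
elim: K => [|K ih]; first by rewrite big_ord0; case: (leP w) => ?; lra.
have KK : K.+1%:R = K%:R + 1 :> R by rewrite natr1.
rewrite big_ord_recr/= KK; case: (leP w (K%:R + 1)) => wK; move: ih; case: (leP w K%:R) => ? /=; lra.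
Qed.

End counting.

Lemma integral_indicT (R : realType) (dT : measure_display)
    (T : measurableType dT) (mu : {measure set T -> \bar R}) (A : set T) :
  measurable A -> (\int[mu]_x (\1_A x)%:E = mu A)%E.
Proof. by move=> mA; rewrite integral_indic// setIT. Qed.

(** * Weak duality for arbitrary laws *)

Section weak_duality.
Context {R : realType} {d : nat}.
Local Notation V := (borelRd R d).
Implicit Types (Q : probability V R) (u z : 'rV[R]_d) (l delta : R).

(* Halfspaces enlarged by (j+1)/(K l): their indicators average to a staircase
   above max 0 (1 - l * gap), at distance at most 1/K. *)
Definition hgrid u z l (K j : nat) : set V :=
  halfspace u (z - (j.+1%:R / (K%:R * l)) *: u).

(** If [x] lies in the halfspace, then [y] lies in every thickening by at least [enorm (x - y)], and
    at least [K - K * l * enorm (x - y)] of the [K] grid thickenings are that wide. *)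
Lemma halfspace_le_grid u z l K (x y : 'rV[R]_d) : enorm u = 1 -> 0 < l ->
  (0 < K)%N ->
  \1_(halfspace u z) x <=
  l * enorm (x - y) + K%:R^-1 * \sum_(j < K) \1_(hgrid u z l K j) y :> R.
Proof.
move=> u1 l0 K0; have K0' : 0 < K%:R :> R by rewrite ltr0n.
have e0 := enorm_ge0 (x - y).
have s0 : 0 <= K%:R^-1 * \sum_(j < K) \1_(hgrid u z l K j) y :> R.
  by rewrite mulr_ge0 ?invr_ge0 ?ler0n// sumr_ge0.
rewrite [leLHS]indicE; case: (boolP (x \in halfspace u z)) => xH; last first.
  by rewrite addr_ge0// mulr_ge0// ltW.
have {}xH : 0 <= dotp u (x - z) by rewrite inE in xH.
have w0 : 0 <= K%:R * (l * enorm (x - y)).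
  by rewrite mulr_ge0 ?ler0n// mulr_ge0// ltW.
have := count_ge K w0.
set S := \sum_(j < K) _ => SK.
have SK' : S <= \sum_(j < K) \1_(hgrid u z l K j) y.
  apply: ler_sum => j _; rewrite indicE.
  case: (leP (K%:R * (l * enorm (x - y)))) => [wj|_]; last by rewrite ler0n.
  rewrite mem_set//; apply/halfspace_shiftE => //.
  have : dotp u (x - y) <= enorm (x - y) by exact: dotp_le_enorm.
  have -> : x - y = (x - z) - (y - z) by rewrite opprB addrA subrK.
  rewrite dotpBr opprB addrA subrK => uxy.
  have : enorm (x - y) <= j.+1%:R / (K%:R * l).
    by rewrite ler_pdivlMr ?mulr_gt0// mulrC -mulrA.
  lra.
have := le_trans SK SK'; set T := \sum_(j < K) _ => KT.
rewrite -lerBlDl [K%:R^-1 * _]mulrC ler_pdivlMr//=; lra.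
Qed.

(** The pointwise bound is integrated against a coupling and then minimised over couplings. Keeping
    a finite average of halfspace masses, rather than the integral of the hinge, allows two laws to
    be compared through halfspaces alone. *)
Lemma weak_duality Q Q' u z l delta K : enorm u = 1 -> 0 < l -> (0 < K)%N ->
  (wasserstein Q' Q <= delta%:E)%E ->
  (Q' (halfspace u z) <=
   (l * delta)%:E + (K%:R^-1)%:E * \sum_(j < K) Q (hgrid u z l K j))%E.
Proof.
move=> u1 l0 K0 WQ.
set S := (X in (_ + X)%E).
have mG j : measurable (hgrid u z l K j) by exact: measurable_halfspace.
have mH := @measurable_halfspace _ _ u z.
have Sfin : S \is a fin_num.
  by rewrite fin_numM// sum_fin_num => //; apply/allP => _ /mapP[j _ ->]; exact: fin_num_measure.
have key (Pi : probability (V * V)%type R) : coupling Q' Q Pi ->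
    (Q' (halfspace u z) <= l%:E * \int[Pi]_p (enorm ((p.1 : 'rV[R]_d) - p.2))%:E + S)%E.
  move=> PiQ; have [Q'E _] := PiQ _ mH.
  have menorm := @measurable_enormB R d.
  have mind : forall j, measurable_fun [set: V * V] (fun p => \1_(hgrid u z l K j) p.2 : R).
    move=> j; apply: (measurableT_comp (f := \1_(hgrid u z l K j) : V -> R)).
      exact: measurable_indic.
    exact: measurable_snd.
  have SE : S = (\int[Pi]_p ((K%:R^-1)%:E * \sum_(j < K) (\1_(hgrid u z l K j) p.2)%:E))%E.
    rewrite ge0_integralZl_EFin//.
    - congr (_ * _)%E; rewrite ge0_integral_sum//.
      + apply: eq_bigr => j _; have [_ <-] := PiQ _ (mG j).
        rewrite -(@integral_indicT _ _ _ Pi (snd @^-1` hgrid u z l K j))//.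
        by rewrite -[X in measurable X]setTI; exact: measurable_snd.
      + by move=> j; exact/measurable_EFinP.
    - by move=> p _; rewrite sume_ge0// => j _; rewrite lee_fin.
    - by apply: emeasurable_sum => j; exact/measurable_EFinP.
  rewrite -Q'E -(integral_indicT Pi); last first.
    by rewrite -[X in measurable X]setTI; exact: measurable_fst.
  rewrite SE -ge0_integralZl_EFin//; last 3 first.
  - by move=> p _; rewrite lee_fin enorm_ge0.
  - exact/measurable_EFinP.
  - exact: ltW.
  have mc : measurable_fun [set: V * V]
      (fun p => (K%:R^-1)%:E * \sum_(j < K) (\1_(hgrid u z l K j) p.2 : R)%:E)%E.
    by apply: measurable_funeM; apply: emeasurable_sum => j; exact/measurable_EFinP.
  have c0 p : (0 <= (K%:R^-1)%:E * \sum_(j < K) (\1_(hgrid u z l K j) p.2 : R)%:E)%E.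
    by rewrite mule_ge0 ?lee_fin ?invr_ge0// sume_ge0// => j _; rewrite lee_fin.
  have e0 (p : V * V) : (0 <= l%:E * (enorm ((p.1 : 'rV[R]_d) - p.2))%:E)%E.
    by rewrite lee_fin mulr_ge0 ?enorm_ge0// ltW.
  have me : measurable_fun [set: V * V]
      (fun p => (l%:E * (enorm ((p.1 : 'rV[R]_d) - p.2))%:E)%E).
    by apply: measurable_funeM; exact/measurable_EFinP.
  rewrite -ge0_integralD//; apply: ge0_le_integral => //.
  - apply/measurable_EFinP; apply: measurable_indic.
    by rewrite -[X in measurable X]setTI; exact: measurable_fst.
  - exact: emeasurable_funD.
  - by move=> p _; rewrite sumEFin -!EFinM -EFinD lee_fin; exact: halfspace_le_grid.
rewrite -(fineK Sfin) in key *.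
have Q'fin : Q' (halfspace u z) \is a fin_num by exact: fin_num_measure.
rewrite -(fineK Q'fin) in key *; rewrite -EFinD lee_fin.
set q := fine _ in key *; set s := fine _ in key *.
(* Solved for the transport cost, the bound [key] passes to the infimum over couplings. *)
rewrite -lerBlDr mulrC -ler_pdivrMr// -lee_fin (le_trans _ WQ)//.
apply/ereal_infP => _ [Pi /key PiQ <-].
have : (l%:E != 0)%E by rewrite eqe gt_eqF.
move: PiQ; case: (integral _ _ _) => [r| |]; rewrite ?leey//.
- by rewrite -EFinM -EFinD !lee_fin -lerBlDr mulrC -ler_pdivrMr.
- by rewrite mulrNy gtr0_sg// mul1e.
Qed.

End weak_duality.

(** * Finitely supported laws *)

Section atomic.
Context {R : realType} {dT : measure_display} {T : measurableType dT}.
Local Open Scope ereal_scope.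

Lemma atomic_probability (I : finType) (w : I -> R) (a : I -> T) :
  (forall i, 0 <= w i)%R -> (\sum_i w i = 1)%R ->
  exists Q : probability T R,
    (forall A, Q A = \sum_i (w i)%:E * \d_(a i) A) /\
    (forall f, measurable_fun setT f -> (forall x, 0 <= f x) ->
       \int[Q]_x f x = \sum_i (w i)%:E * f (a i)).
Proof.
move=> w0 w1.
(* [msum] is indexed by natural numbers, so [I] is enumerated and the zero measure fills the indices
   beyond it. *)
pose m (k : nat) : {measure set T -> \bar R} :=
  if insub k is Some i
  then mscale (NngNum (w0 (enum_val (i : 'I_#|I|)))) \d_(a (enum_val i))
  else mzero.
have mE (F : {measure set T -> \bar R} -> \bar R) (G : I -> \bar R) :
    (forall i, F (mscale (NngNum (w0 i)) \d_(a i)) = G i) ->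
    \sum_(k < #|I|) F (m k) = \sum_i G i.
  move=> FG; rewrite [RHS](reindex _ (onW_bij _ (enum_val_bij I)))/=.
  by apply: eq_bigr => k _; rewrite /m valK FG.
have QE A : msum m #|I| A = \sum_i (w i)%:E * \d_(a i) A.
  by rewrite /msum; exact: (mE (fun m => m A)).
have QT : msum m #|I| setT = 1.
  rewrite QE -[1]/(1%R%:E) -w1 -sumEFin; apply: eq_bigr => i _.
  by rewrite diracT mule1.
pose Q : probability T R := HB.pack (msum m #|I|)
  (Measure_isProbability.Build _ _ _ (msum m #|I|) QT).
exists Q; split=> [//|f mf f0].
rewrite (@ge0_integral_measure_sum _ _ _ m _ measurableT)//.
apply: (mE (fun m => \int[m]_x f x)) => i.
by rewrite ge0_integral_mscale//= integral_dirac// diracT mul1e.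
Qed.

End atomic.

(** * Greedy solution of the fractional knapsack problem *)

Section greedy.
Context {R : realType} {I : finType}.
Implicit Types (g phi : I -> R) (D : R).

(** The threshold [t] is the least value of [g] for which serving all indices with [g i <= t]
    overruns the budget [D]. *)
Lemma greedy_split g D : (forall i, 0 <= g i) -> 0 <= D -> D < \sum_i g i ->
  exists t, \sum_(i | g i < t) g i <= D < \sum_(i | g i <= t) g i.
Proof.
move=> g0 D0 Dg.
have [i0 _|I0] := pickP (fun i : I => true); last first.
  by move: Dg; rewrite big_pred0 ?ltNge ?D0.
pose P i := D < \sum_(j | g j <= g i) g j.
have [i1 _ gi1] := @arg_maxP _ _ _ i0 xpredT g isT.
have Pi1 : P i1.
  rewrite /P (eq_bigl xpredT)// => j; exact: gi1.
have [i Pi gi] := @arg_minP _ _ _ i1 P g Pi1.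
exists (g i); rewrite andbC; apply/andP; split=> //.
have [j1 j1i|no] := pickP (fun j => g j < g i); last by rewrite big_pred0.
have [j ji gj] := @arg_maxP _ _ _ j1 (fun j => g j < g i) g j1i.
(* The indices strictly below the threshold are those up to the next smaller value [g j]; by
   minimality of the threshold, they fit in the budget. *)
rewrite (eq_bigl (fun k => g k <= g j)); last first.
  move=> k; apply/idP/idP => [/gj//|kj]; exact: le_lt_trans ji.
rewrite leNgt; apply/negP => /gi.
by rewrite leNgt ji.
Qed.

(* phi is 1 below the threshold t, 0 above it, and on {g = t} the fraction
   that spends exactly the budget D; then l = 1/t. *)
Lemma greedy_duality g D : (forall i, 0 <= g i) -> 0 <= D ->
  exists phi, [/\ forall i, 0 <= phi i <= 1, \sum_i phi i * g i <= D &
    \sum_i phi i = #|I|%:R \/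
    exists2 l, 0 < l &
      \sum_i phi i = l * D + \sum_i Num.max 0 (1 - l * g i)].
Proof.
move=> g0 D0; have [gD|Dg] := leP (\sum_i g i) D.
  exists (fun=> 1); split.
  - by move=> i; rewrite ler01 lexx.
  - by under eq_bigr do rewrite mul1r.
  - by left; rewrite sumr_const.
have [t /andP[tD Dt]] := greedy_split g0 D0 Dg.
have Bt (F : I -> R) : \sum_(i | g i <= t) F i =
    \sum_(i | g i < t) F i + \sum_(i | g i == t) F i.
  rewrite (bigID (fun i => g i < t))/=; congr (_ + _); apply: eq_bigl => i.
    by case: ltgtP.
  by case: ltgtP.
pose A := \sum_(i | g i < t) g i; pose B := \sum_(i | g i == t) g i.
have AB : D < A + B by rewrite -Bt.
have B0 : 0 < B by move: tD AB; rewrite -/A; lra.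
have t0 : 0 < t.
  rewrite ltNge; apply/negP => t0; move: B0; rewrite ltNge => /negP; apply.
  by rewrite sumr_le0// => i /eqP ->.
pose k := (D - A) / B.
have k0 : 0 <= k by rewrite divr_ge0 ?subr_ge0// ltW.
have k1 : k <= 1 by rewrite ler_pdivrMr//; lra.
pose phi i := if g i < t then 1 else if g i == t then k else 0.
have phig : \sum_i phi i * g i = D.
  rewrite (bigID (fun i => g i <= t))/= [X in _ + X]big1 => [|i]; last first.
    by rewrite /phi; case: ltgtP => //; rewrite mul0r.
  rewrite addr0 Bt; have -> : \sum_(i | g i < t) phi i * g i = A.
    by apply: eq_bigr => i it; rewrite /phi it mul1r.
  have -> : \sum_(i | g i == t) phi i * g i = k * B.
    rewrite mulr_sumr; apply: eq_bigr => i it; rewrite /phi it.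
    by rewrite (eqP it) ltxx.
  by rewrite /k divfK ?gt_eqF//; lra.
exists phi; split.
- by move=> i; rewrite /phi; case: ltgtP; rewrite ?k0 ?k1 ?ler01 ?lexx.
- by rewrite phig.
right; exists t^-1; first by rewrite invr_gt0.
rewrite -{1}phig mulr_sumr -big_split/=; apply: eq_bigr => i _.
rewrite /phi; case: ltgtP => it.
- rewrite mul1r (max_idPr _); first by rewrite addrC subrK.
  by rewrite subr_ge0 mulrC ler_pdivrMr// mul1r ltW.
- rewrite mul0r mulr0 add0r (max_idPl _)//.
  by rewrite subr_le0 mulrC ler_pdivlMr// mul1r ltW.
- by rewrite it mulVf ?gt_eqF// subrr maxxx addr0 mulrCA mulVf ?gt_eqF// mulr1.
Qed.

End greedy.

(** * The dual formula for empirical laws *)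

Section depth_duality.
Context {R : realType} {d : nat}.
Local Notation V := (borelRd R d).
Implicit Types (Q : probability V R) (u z : 'rV[R]_d) (l delta a : R).

Definition hgap u z (x : 'rV[R]_d) : R := Num.max 0 (dotp u (z - x)).

(** The Lagrange dual objective for the largest mass of the halfspace under the transport budget
    [delta], with [l] the price of transport. *)
Definition dual delta n (x : 'I_n -> 'rV[R]_d) u z l : R :=
  l * delta + n%:R^-1 * \sum_(i < n) Num.max 0 (1 - l * hgap u z (x i)).

Lemma hgap_ge0 u z x : 0 <= hgap u z x.
Proof. by rewrite /hgap le_max lexx. Qed.

Lemma empiricalE n (n0 : (0 < n)%N) (x : 'I_n -> 'rV[R]_d) (A : set V) :
  empirical n0 x A = (n%:R^-1 * \sum_(i < n) \1_A (x i : V))%:E.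
Proof.
rewrite /empirical EFinM -sumEFin; congr (_ * _)%E.
Qed.

(** A sample point lies in those grid sets whose thickening reaches its gap; [count_le] bounds their
    share by the hinge plus [1 / K]. *)
Lemma empirical_grid_le n (n0 : (0 < n)%N) (x : 'I_n -> 'rV[R]_d) u z l K :
  enorm u = 1 -> 0 < l -> (0 < K)%N ->
  K%:R^-1 * \sum_(j < K) (n%:R^-1 * \sum_(i < n) \1_(hgrid u z l K j) (x i : V))
    <= n%:R^-1 * \sum_(i < n) Num.max 0 (1 - l * hgap u z (x i)) + K%:R^-1 :> R.
Proof.
move=> u1 l0 K0.
have nR0 : 0 < n%:R :> R by rewrite ltr0n.
have KR0 : 0 < K%:R :> R by rewrite ltr0n.
rewrite -mulr_sumr mulrCA exchange_big/=.
rewrite [X in _ <= _ + X](_ : _ = n%:R^-1 * \sum_(i < n) K%:R^-1); last first.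
  by rewrite sumr_const card_ord -[K%:R^-1 *+ n]mulr_natl mulKf// gt_eqF.
rewrite -mulrDr ler_pM2l ?invr_gt0// -big_split/= mulr_sumr.
apply: ler_sum => i _; rewrite mulrC ler_pdivrMr// mulrDl mulVf ?gt_eqF//.
rewrite mulrC maxr_pMr ?(ltW KR0)// mulr0 mulrBr mulr1.
apply: le_trans (count_le _ K).
apply: ler_sum => j _; rewrite indicE ler_nat.
have [|//] := boolP (_ \in _); rewrite inE => /halfspace_shiftE -/(_ u1) xj.
rewrite lt0b mulrA -ler_pdivlMl ?mulr_gt0// /hgap ge_max.
rewrite mulrC divr_ge0 ?ler0n ?mulr_ge0 ?ler0n ?(ltW l0)//=.
by rewrite -opprB dotpNr lerNl.
Qed.

(** Weak duality, with each grid mass under [Q] replaced by the sample mass at the cost [e]. For [Q]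
    the sample itself and [e = 0] this is half of the dual formula; for [Q] the population law it
    carries depth over to samples. *)
Lemma depth_le_dual Q n (n0 : (0 < n)%N) (x : 'I_n -> 'rV[R]_d) delta a e z :
  (forall u z', enorm u = 1 ->
     (Q (halfspace u z') <= empirical n0 x (halfspace u z') + e%:E)%E) ->
  (a%:E <= depth delta Q z)%E ->
  forall u l, enorm u = 1 -> 0 < l -> a - e <= dual delta x u z l.
Proof.
move=> Qx aQ u l u1 l0; rewrite lerBlDr; apply/ler_addgt0Pr => r r0.
pose K := (Num.truncn r^-1).+1.
have KR0 : 0 < K%:R :> R by rewrite ltr0n.
have Kr : K%:R^-1 <= r.
  by rewrite invf_ple ?posrE// ltW// truncnS_gt.
apply: le_trans (_ : dual delta x u z l + e + K%:R^-1 <= _); last by rewrite lerD2l.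
rewrite -lee_fin; apply: le_trans aQ _; apply: ge_ereal_inf.
eexists; first by exists u.
apply/ereal_supP => _ [Q' /(weak_duality z u1 l0 (ltn0Sn (Num.truncn r^-1))) QQ <-].
apply: le_trans QQ _; rewrite -/K.
apply: (@le_trans _ _ ((l * delta)%:E + (K%:R^-1)%:E * \sum_(j < K)
   (n%:R^-1 * (\sum_(i < n) \1_(hgrid u z l K j) (x i : V)) + e)%:E)%E).
  rewrite leeD2l// lee_pmul2l ?lte_fin ?invr_gt0//; apply: lee_sum => j _.
  by rewrite EFinD -empiricalE; exact: Qx.
rewrite sumEFin -EFinM -EFinD lee_fin /dual -!addrA lerD2l.
rewrite big_split/= sumr_const card_ord mulrDr -[e *+ K]mulr_natl mulKf ?gt_eqF//.
by rewrite [e + _]addrC addrA lerD2r; exact: empirical_grid_le.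
Qed.

(** A fraction [phi i] of the [i]-th atom is carried along [u] over the distance [hgap u z (x i)],
    which lands it in the halfspace; the rest stays. *)
Lemma transport_to_halfspace n (n0 : (0 < n)%N) (x : 'I_n -> 'rV[R]_d) delta u z
    (phi : 'I_n -> R) : enorm u = 1 ->
  (forall i, 0 <= phi i <= 1) ->
  \sum_(i < n) phi i * hgap u z (x i) <= n%:R * delta ->
  exists2 Q' : probability V R, (wasserstein Q' (empirical n0 x) <= delta%:E)%E &
    ((n%:R^-1 * \sum_(i < n) phi i)%:E <= Q' (halfspace u z))%E.
Proof.
move=> u1 phi01 phid.
have nR0 : 0 < n%:R :> R by rewrite ltr0n.
(* The Boolean tells the carried piece of an atom from the piece left behind; [at2] pairs new with
   old positions and so describes the coupling. *)
pose w (p : 'I_n * bool) := n%:R^-1 * (if p.2 then phi p.1 else 1 - phi p.1).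
pose at1 (p : 'I_n * bool) : V :=
  if p.2 then x p.1 + hgap u z (x p.1) *: u else x p.1.
pose at2 (p : 'I_n * bool) : V * V := (at1 p, x p.1).
have sumw (F : 'I_n * bool -> R) : \sum_p w p * F p =
    n%:R^-1 * \sum_(i < n) (phi i * F (i, true) + (1 - phi i) * F (i, false)).
  rewrite (eq_bigr (fun p => w (p.1, p.2) * F (p.1, p.2))) => [|[]//].
  rewrite -(pair_bigA _ (fun i b => w (i, b) * F (i, b)))/= mulr_sumr.
  by apply: eq_bigr => i _; rewrite big_bool/= /w/=; ring.
have w0 p : 0 <= w p.
  rewrite mulr_ge0 ?invr_ge0//; case: ifP => _; have /andP[] := phi01 p.1; lra.
have w1 : \sum_p w p = 1.
  under eq_bigr do rewrite -[w _]mulr1.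
  rewrite (sumw (fun=> 1)) (eq_bigr (fun=> 1)); last by move=> i _; ring.
  by rewrite sumr_const card_ord mulVf// gt_eqF.
have [Q' [Q'E _]] := atomic_probability at1 w0 w1.
have [Pi [PiE Piint]] := atomic_probability at2 w0 w1.
exists Q'; last first.
  rewrite Q'E (eq_bigr (fun p => (w p * \1_(halfspace u z) (at1 p))%:E)) => [|p _]; last first.
    by rewrite EFinM /dirac.
  rewrite sumEFin sumw lee_fin ler_pM2l ?invr_gt0//; apply: ler_sum => i _.
  (* Carried pieces count fully; pieces left behind may lie in the halfspace as well, hence an
     inequality. *)
  rewrite /at1/= [\1_(halfspace _ _) (_ + _)]indicE mem_set ?mulr1.
    have /andP[_ phi1] := phi01 i.
    by rewrite lerDl mulr_ge0// subr_ge0.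
  rewrite /halfspace/= addrAC dotpDr dotpZr (enorm1 u1) mulr1.
  have : dotp u (z - x i) <= hgap u z (x i) by rewrite /hgap le_max lexx orbT.
  by rewrite -opprB dotpNr; lra.
apply: ge_ereal_inf; exists (\int[Pi]_p (enorm ((p.1 : 'rV[R]_d) - p.2))%:E)%E.
  exists Pi => // A mA; split; first by rewrite PiE Q'E; exact: eq_bigr.
  rewrite PiE [RHS]empiricalE (eq_bigr (fun p => (w p * \1_A (x p.1 : V))%:E)) => [|p _]; last first.
    by rewrite EFinM /dirac.
  rewrite sumEFin sumw/=; congr (_ * _)%:E; apply: eq_bigr => i _; ring.
rewrite Piint; last 2 first.
- by apply/measurable_EFinP; exact: measurable_enormB.
- by move=> p; rewrite lee_fin enorm_ge0.
under eq_bigr do rewrite -EFinM.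
rewrite sumEFin sumw lee_fin ler_pdivrMl//; apply: le_trans phid.
have e1 (v w' : 'rV[R]_d) : v + w' - v = w' by rewrite addrC addKr.
have e0 (v : 'rV[R]_d) : enorm (v - v) = 0.
  by rewrite subrr /enorm /dotp big1 ?sqrtr0// => i _; rewrite mxE mul0r.
apply: ler_sum => i _; rewrite /at1/= [X in _ + _ * X]e0 mulr0 addr0.
by rewrite [X in _ * enorm X]e1 (enormZ_ge0 u1 (hgap_ge0 _ _ _)).
Qed.

(* When even phi = 1 respects the budget, the optimal multiplier is l = 0,
   which is approached by l -> 0+. *)
Lemma dual_le_depth n (n0 : (0 < n)%N) (x : 'I_n -> 'rV[R]_d) delta a z :
  0 <= delta ->
  (forall u l, enorm u = 1 -> 0 < l -> a <= dual delta x u z l) ->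
  (a%:E <= depth delta (empirical n0 x) z)%E.
Proof.
move=> delta0 ad; apply/ereal_infP => _ [u /= u1 <-].
have nR0 : 0 < n%:R :> R by rewrite ltr0n.
have [phi [phi01 phid phiE]] := greedy_duality
  (fun i => hgap_ge0 u z (x i)) (mulr_ge0 (ltW nR0) delta0).
have [Q' WQ' Q'H] := transport_to_halfspace n0 u1 phi01 phid.
apply: le_ereal_sup_tmp; exists (Q' (halfspace u z)); first by exists Q'.
apply: le_trans Q'H; rewrite lee_fin.
case: phiE => [->|[l l0 ->]]; last first.
  by rewrite mulrDr mulrCA mulKf ?gt_eqF//; exact: ad.
rewrite card_ord mulVf ?gt_eqF//; apply/ler_addgt0Pr => r r0.
have d1 : 0 < delta + 1 by lra.
(* At this price the transport term is at most [r], and each hinge is at most 1. *)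
apply: le_trans (ad u (r / (delta + 1)) u1 _) _; first exact: divr_gt0.
rewrite /dual [1 + r]addrC lerD//.
  by rewrite mulrAC -mulrA ger_pMr// ler_pdivrMr//; lra.
rewrite ler_pdivrMl// mulr1 -[X in _ <= X%:R](card_ord n) -sumr_const.
apply: ler_sum => i _; rewrite ge_max ler01/= gerBl mulr_ge0 ?hgap_ge0//.
by rewrite divr_ge0// ltW.
Qed.

Lemma depth_dualP n (n0 : (0 < n)%N) (x : 'I_n -> 'rV[R]_d) delta a z :
  0 <= delta ->
  (a%:E <= depth delta (empirical n0 x) z)%E <->
  (forall u l, enorm u = 1 -> 0 < l -> a <= dual delta x u z l).
Proof.
move=> delta0; split=> [ad u l u1 l0|]; last exact: dual_le_depth.
rewrite -[a]subr0; apply: (depth_le_dual (n0 := n0)) ad _ _ u1 l0.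
by move=> ? ? _; rewrite adde0.
Qed.

End depth_duality.

(** * Breakdown of the level sets *)

Section breakdown.
Context {R : realType} {d : nat}.
Local Notation V := (borelRd R d).
Implicit Types (A B : set 'rV[R]_d) (u z : 'rV[R]_d) (l s delta alpha r M : R).

(** For the unit vector [u] along [a - b], the distance is [dotp u a + dotp (- u) b], and both terms
    are at most [r]. *)
Lemma hausdorff_dist_le A B r : 0 <= r -> A !=set0 -> B !=set0 ->
  (forall z u, A z \/ B z -> enorm u = 1 -> dotp u z <= r) ->
  (hausdorff_dist A B <= (r + r)%:E)%E.
Proof.
move=> r0 [a0 Aa0] [b0 Bb0] ABr.
have enorm_le a b : A a -> B b -> enorm (a - b) <= r + r.
  move=> Aa Bb; have [->|/enorm_unit[u [u1 <-]]] := eqVneq (a - b) 0.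
    by rewrite /enorm /dotp big1 ?sqrtr0 ?addr_ge0// => i _; rewrite mxE mul0r.
  rewrite dotpBr -dotpNl lerD// ABr ?enormN//; by [left|right].
rewrite /hausdorff_dist; case: asboolP => [[A0|B0]|_].
- by move: Aa0; rewrite A0.
- by move: Bb0; rewrite B0.
rewrite ge_max; apply/andP; split; apply/ereal_supP.
- move=> _ [a Aa <-]; apply: ge_ereal_inf; exists (enorm (a - b0))%:E; first by exists b0.
  by rewrite lee_fin enorm_le.
- move=> _ [b Bb <-]; apply: ge_ereal_inf; exists (enorm (a0 - b))%:E; first by exists a0.
  by rewrite lee_fin enorm_le.
Qed.

(** The distance from the single point [b] to [A] is already this large; an empty [A] gives infinity
    by convention. *)
Lemma hausdorff_dist_ge A B r u b : enorm u = 1 ->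
  (forall z, A z -> dotp u z <= r) -> B b ->
  ((dotp u b - r)%:E <= hausdorff_dist A B)%E.
Proof.
move=> u1 Ar Bb; rewrite /hausdorff_dist; case: asboolP => [_|_]; first exact: leey.
rewrite le_max; apply/orP; right; apply: le_ereal_sup_tmp.
exists (ereal_inf [set (enorm (a - b))%:E | a in A]); first by exists b.
apply/ereal_infP => _ [a Aa <-]; rewrite lee_fin -enormN opprB.
by apply: le_trans (dotp_le_enorm _ u1); rewrite dotpBr lerB// Ar.
Qed.

(** Were [dotp u z] larger, the price [l = (alpha - m / n) / (delta + 1)] would violate the dual
    bound: the hinges vanish on [J], the at most [m] others are at most 1, and
    [l * delta + m / n < alpha]. *)
Lemma level_bounded n (X : 'I_n -> 'rV[R]_d) (J : pred 'I_n) (m : nat)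
    delta alpha M z : (0 < n)%N -> 0 <= delta ->
  (forall i u, J i -> enorm u = 1 -> dotp u (X i) <= M) ->
  (#|[predC J]| <= m)%N -> m%:R / n%:R < alpha ->
  (forall u l, enorm u = 1 -> 0 < l -> alpha <= dual delta X u z l) ->
  forall u, enorm u = 1 -> dotp u z <= M + (delta + 1) / (alpha - m%:R / n%:R).
Proof.
move=> n0 delta0 JM Jm ma zX u u1; rewrite leNgt; apply/negP => uz.
have nR0 : 0 < n%:R :> R by rewrite ltr0n.
have rho0 : 0 < alpha - m%:R / n%:R by lra.
set rho := alpha - _ in uz rho0.
have d1 : 0 < delta + 1 by lra.
pose t := (delta + 1) / rho; have t0 : 0 < t by rewrite divr_gt0.
have := zX u t^-1 u1; rewrite invr_gt0 => /(_ t0); apply/negP; rewrite -ltNge.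
have sumle : \sum_(i < n) Num.max 0 (1 - t^-1 * hgap u z (X i)) <= m%:R.
  rewrite (bigID J)/= big1 ?add0r => [|i Ji]; last first.
    apply/max_idPl; rewrite subr_le0 ler_pdivlMl// mulr1 /hgap le_max.
    by rewrite dotpBr; have := JM i u Ji u1; move: uz; rewrite -/t => ? ?; apply/orP; right; lra.
  apply: le_trans (_ : #|[predC J]|%:R <= _); last by rewrite ler_nat.
  rewrite -sumr_const; apply: ler_sum => i _; rewrite ge_max ler01/= gerBl.
  by rewrite mulr_ge0 ?hgap_ge0// invr_ge0 ltW.
apply: (@le_lt_trans _ _ (t^-1 * delta + m%:R / n%:R)).
  by rewrite lerD2l [leRHS]mulrC ler_pM2l ?invr_gt0.
rewrite -ltrBrDr -/rho /t invf_div mulrAC ltr_pdivrMr// ltr_pM2l//; lra.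
Qed.

Lemma pooled_lshift n m (x : 'I_n -> 'rV[R]_d) (y : 'I_m -> 'rV[R]_d) i :
  pooled x y (lshift m i) = x i.
Proof. by rewrite /pooled (unsplitK (inl i)). Qed.

Lemma pooled_rshift n m (x : 'I_n -> 'rV[R]_d) (y : 'I_m -> 'rV[R]_d) i :
  pooled x y (rshift n i) = y i.
Proof. by rewrite /pooled (unsplitK (inr i)). Qed.

Lemma dual_pooled n m (x : 'I_n -> 'rV[R]_d) (y : 'I_m -> 'rV[R]_d) delta u z l :
  dual delta (pooled x y) u z l = l * delta + (n + m)%:R^-1 *
    (\sum_(i < n) Num.max 0 (1 - l * hgap u z (x i)) +
     \sum_(i < m) Num.max 0 (1 - l * hgap u z (y i))).
Proof.
rewrite /dual big_split_ord/=; congr (_ + _ * (_ + _)); apply: eq_bigr => i _.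
  by rewrite pooled_lshift.
by rewrite pooled_rshift.
Qed.

Lemma gap_sum_ge0 n (x : 'I_n -> 'rV[R]_d) u z l :
  0 <= \sum_(i < n) Num.max 0 (1 - l * hgap u z (x i)).
Proof. by rewrite sumr_ge0// => i _; rewrite le_max lexx. Qed.

Lemma dual_scale n (x : 'I_n -> 'rV[R]_d) delta s u z l : 0 < s ->
  s * dual (delta / s) x u z l =
  l * delta + s / n%:R * \sum_(i < n) Num.max 0 (1 - l * hgap u z (x i)).
Proof.
by move=> s0; rewrite /dual mulrDr !mulrA; congr (_ + _); field; rewrite gt_eqF.
Qed.

Lemma dual_scale_le n (x : 'I_n -> 'rV[R]_d) delta s u z l : 0 < s <= 1 ->
  s * dual (delta / s) x u z l <= dual delta x u z l.
Proof.
move=> /andP[s0 s1]; rewrite dual_scale// lerD2l ler_wpM2r ?gap_sum_ge0//.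
by rewrite -[leRHS]mul1r ler_wpM2r// invr_ge0.
Qed.

(** Each old point keeps the weight [1 / (n + m)], which is at least [s / n], and the new hinges are
    nonnegative. *)
Lemma dual_scale_le_pooled n m (x : 'I_n -> 'rV[R]_d) (y : 'I_m -> 'rV[R]_d)
    delta s u z l : (0 < n)%N -> 0 < s <= n%:R / (n + m)%:R ->
  s * dual (delta / s) x u z l <= dual delta (pooled x y) u z l.
Proof.
move=> n0 /andP[s0 sn]; have nR0 : 0 < n%:R :> R by rewrite ltr0n.
rewrite dual_scale// dual_pooled lerD2l.
apply: le_trans (_ : (n + m)%:R^-1 * \sum_(i < n) Num.max 0 (1 - l * hgap u z (x i)) <= _).
  by rewrite ler_wpM2r ?gap_sum_ge0// ler_pdivrMr// mulrC.
by rewrite ler_wpM2l ?invr_ge0// lerDl gap_sum_ge0.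
Qed.

(** * The breakdown point, given one deep location *)

Section breakdown_point.
Variables (d0 : (0 < d)%N) (n : nat) (n0 : (0 < n)%N) (x : 'I_n -> 'rV[R]_d).
Variables (delta alpha s : R) (z : 'rV[R]_d).
Hypotheses (delta0 : 0 <= delta) (alpha0 : 0 < alpha) (alpha1 : alpha < 1).
Hypotheses (s0 : 0 < s) (s1 : s <= 1 - alpha).
(** In dual form: [z] has depth at least [alpha / s] for the budget [delta / s]. Both halves of the
    theorem supply this with [s = 1 - alpha_star], from a maximiser for the sample or from a
    near-maximiser for the population law. *)
Hypothesis deep : forall u l, enorm u = 1 -> 0 < l ->
  alpha <= s * dual (delta / s) x u z l.

Let M := \sum_(i < n) enorm (x i).

Let xM i u : enorm u = 1 -> dotp u (x i) <= M.
Proof.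
move=> u1; apply: le_trans (dotp_le_enorm _ u1) _.
by rewrite /M (bigD1 i)//= lerDl sumr_ge0// => j _; rewrite enorm_ge0.
Qed.

Let M0 : 0 <= M. Proof. by rewrite sumr_ge0// => i _; exact: enorm_ge0. Qed.

Let Ux := upper_level delta alpha (empirical n0 x).
Let Uxy m (y : 'I_m -> 'rV[R]_d) :=
  upper_level delta alpha (empirical (ltn_addr m n0) (pooled x y)).

Let Ux_bounded : exists2 r, 0 <= r &
  forall w u, Ux w -> enorm u = 1 -> dotp u w <= r.
Proof.
exists (M + (delta + 1) / (alpha - 0%:R / n%:R)).
  by rewrite mul0r subr0 addr_ge0// divr_ge0 ?(ltW alpha0)// addr_ge0.
move=> w u /(depth_dualP n0 x _ _ delta0) wx u1.
apply: (level_bounded (J := xpredT) (m := 0)) wx _ u1 => //.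
- by move=> i v _; exact: xM.
- by rewrite leqn0; apply/eqP; apply: eq_card0 => i; rewrite inE.
- by rewrite mul0r.
Qed.

Let breakdown_sup m : (alpha <= m%:R / (m + n)%:R) ->
  ereal_sup (range (fun y : 'I_m -> 'rV[R]_d => hausdorff_dist Ux (Uxy y))) = +oo%E.
Proof.
move=> am; have [r r0 Uxr] := Ux_bounded.
pose e : 'rV[R]_d := delta_mx 0 (Ordinal d0).
have e1 : enorm e = 1 by exact: enorm_delta.
apply/eqyP => c _.
(* All new points sit at [b], beyond the old level set by [c]. Their hinges at [b] are 1, so the
   dual value there is at least [m / (m + n)], hence at least [alpha]. *)
pose b := (c + r) *: e; pose y (i : 'I_m) := b.
apply: le_ereal_sup_tmp; exists (hausdorff_dist Ux (Uxy y)); first by exists y.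
have -> : c = dotp e b - r by rewrite dotpZr (enorm1 e1) mulr1 addrK.
apply: hausdorff_dist_ge => // [w /Uxr|]; first exact.
apply/depth_dualP => // u l u1 l0; apply: le_trans am _.
rewrite dual_pooled [leRHS]addrC -[leLHS]addr0 lerD ?mulr_ge0// ?(ltW l0)//.
rewrite mulrC addnC ler_wpM2l ?invr_ge0// -[leLHS]add0r lerD ?gap_sum_ge0//.
rewrite -[X in X%:R <= _](card_ord m) -sumr_const; apply: ler_sum => i _.
by rewrite /hgap /y subrr /dotp big1 ?maxxx ?mulr0 ?subr0 ?le_max ?lexx ?orbT// => j _;
  rewrite mxE mulr0.
Qed.

Let no_breakdown_sup m : (m%:R / (m + n)%:R < alpha) ->
  ereal_sup (range (fun y : 'I_m -> 'rV[R]_d => hausdorff_dist Ux (Uxy y))) != +oo%E.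
Proof.
move=> ma; have [r1 r10 Uxr] := Ux_bounded.
have nR0 : 0 < n%:R :> R by rewrite ltr0n.
have nmR0 : 0 < (n + m)%:R :> R by rewrite ltr0n ltn_addr.
(* The bound is uniform in [y]: the old points are the controlled ones, and the new ones carry mass
   below [alpha]. *)
have [r2 r20 Uxyr] : exists2 r, 0 <= r &
    forall (y : 'I_m -> 'rV[R]_d) w u, Uxy y w -> enorm u = 1 -> dotp u w <= r.
  exists (M + (delta + 1) / (alpha - m%:R / (n + m)%:R)).
    rewrite addr_ge0// divr_ge0//; first exact: addr_ge0.
    by rewrite subr_ge0 addnC ltW.
  move=> y w u /depth_dualP-/(_ delta0) wx u1.
  apply: (level_bounded (J := fun i => (i < n)%N) (m := m)) wx _ u1 => //.
  - exact: ltn_addr.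
  - move=> i v ni v1; have -> : i = lshift m (Ordinal ni) by exact/val_inj.
    by rewrite pooled_lshift xM.
  - rewrite -(leq_add2l #|[pred i : 'I_(n + m) | (i < n)%N]|) cardC card_ord leq_add2r.
    pose f (i : 'I_n) := lshift m i.
    rewrite -[X in (X <= _)%N]card_ord -(card_codom (f := f)).
      by apply/subset_leq_card/fintype.subsetP => _ /codomP[i ->]; rewrite inE/=.
    exact: lshift_inj.
  - by rewrite addnC.
have s1' : s <= 1 by apply: le_trans s1 _; rewrite gerBl ltW.
have Ux0 : Ux !=set0.
  exists z; apply/depth_dualP => // u l u1 l0.
  by apply: le_trans (deep u1 l0) _; rewrite dual_scale_le// s0.
(* The same [z] stays in the level set for every [y], because [s <= 1 - alpha <= n / (n + m)]. *)
have Uxy0 (y : 'I_m -> 'rV[R]_d) : Uxy y !=set0.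
  exists z; apply/depth_dualP => // u l u1 l0.
  apply: le_trans (deep u1 l0) _; rewrite dual_scale_le_pooled// s0/=.
  apply: (le_trans s1); move: ma; rewrite addnC ltr_pdivrMr// ler_pdivlMr//.
  by rewrite natrD; lra.
rewrite -ltey; apply: le_lt_trans (ltry (r1 + r2 + (r1 + r2))).
apply/ereal_supP => _ [y _ <-].
apply: (hausdorff_dist_le (addr_ge0 r10 r20) Ux0 (Uxy0 y)).
by move=> w u [/Uxr|/Uxyr] /[apply] => uw; apply: le_trans uw _; lra.
Qed.

(** Breakdown occurs exactly when [alpha <= m / (m + n)], that is, when [m] is at least
    [q = n * alpha / (1 - alpha)]; the least such [m] is the ceiling of [q]. *)
Lemma breakdown_pointE : breakdown_point delta alpha n0 x =
  let k : R := (Num.ceil (n%:R * alpha / (1 - alpha)))%:~R in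
  (k / (n%:R + k))%:E.
Proof.
have nR0 : 0 < n%:R :> R by rewrite ltr0n.
set q := n%:R * alpha / (1 - alpha).
have q0 : 0 < q by rewrite divr_gt0 ?mulr_gt0// subr_gt0.
have qa (m : nat) : (alpha <= m%:R / (m + n)%:R) = (q <= m%:R).
  rewrite ler_pdivlMr ?ltr0n ?addn_gt0 ?n0 ?orbT// ler_pdivrMr ?subr_gt0//.
  by rewrite natrD; apply/idP/idP; lra.
have k0 : 0 <= Num.ceil q by rewrite ceil_ge0 (lt_trans _ q0)// ltrN10.
pose k := `|Num.ceil q|%N.
have kE : (Num.ceil q)%:~R = k%:R :> R by rewrite /k natr_absz ger0_norm.
rewrite /= kE.
have qk : q <= k%:R by rewrite -kE ceil_ge.
have qkm (m : nat) : q <= m%:R -> (k <= m)%N.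
  by move=> qm; rewrite -lez_nat /k gez0_abs// ceil_le_int.
rewrite /breakdown_point; apply/eqP; rewrite eq_le; apply/andP; split.
  apply: ge_ereal_inf; exists (k%:R / (k + n)%:R)%:E.
    by exists k => //; apply: breakdown_sup; rewrite qa.
  by rewrite natrD addrC.
apply/ereal_infP => _ [m /= mS <-].
have km : (k <= m)%N.
  apply: qkm; rewrite -qa leNgt; apply/negP => /no_breakdown_sup.
  by rewrite mS eqxx.
rewrite lee_fin natrD ler_pdivrMr ?ltr_wpDr// mulrAC ler_pdivlMr ?ltr_wpDl//.
have kmR : k%:R <= m%:R :> R by rewrite ler_nat.
by rewrite !mulrDr [k%:R * m%:R]mulrC addrC lerD2r ler_wpM2r.
Qed.

End breakdown_point.
End breakdown.

(** * Attainment of the maximal depth *)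

Section max_depth_attained.
Context {R : realType} {d : nat}.
Implicit Types (u v x z : 'rV[R]_d) (l delta alpha a b : R).

Lemma coord_le_norm x i : `|x 0 i| <= `|x|.
Proof.
have /mapP[j Hj ->] : `|x 0 i| \in [seq `|x p.1 p.2| | p : 'I_1 * 'I_d].
  by apply/mapP; exists (0, i) => //=; rewrite mem_enum.
by rewrite [leRHS]/Num.norm /= mx_normrE; apply/bigmax_geP; right => /=; exists j.
Qed.

(** The norm here is the max norm, in which balls and compactness are expressed; hence the factor
    [d]. *)
Lemma dotp_le_norm u x : `|dotp u x| <= d%:R * (`|u| * `|x|).
Proof.
apply: le_trans (ler_norm_sum _ _ _) _.
rewrite mulr_natl -[X in _ *+ X](card_ord d) -sumr_const; apply: ler_sum => i _.
by rewrite normrM ler_pM ?coord_le_norm.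
Qed.

Lemma clipped_gap_lipschitz l a b : 0 <= l ->
  Num.max 0 (1 - l * Num.max 0 a) <= Num.max 0 (1 - l * Num.max 0 b) + l * `|b - a|.
Proof.
move=> l0; have ba := ler_norm (b - a); have c0 := normr_ge0 (b - a).
have gap : Num.max 0 b <= Num.max 0 a + `|b - a|.
  by case: (leP 0 a) => ?; case: (leP 0 b) => ?; lra.
have := ler_wpM2l l0 gap; rewrite mulrDr; set B := l * Num.max 0 b; set A := l * Num.max 0 a.
have := mulr_ge0 l0 c0; set C := l * `|b - a| => C0 BAC.
case: (leP 0 (1 - A)) => ?; case: (leP 0 (1 - B)) => ?; lra.
Qed.

Lemma dual_lipschitz n (x : 'I_n -> 'rV[R]_d) delta u z z' l : (0 < n)%N ->
  0 <= l ->
  dual delta x u z l <= dual delta x u z' l + l * (d%:R * (`|u| * `|z' - z|)).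
Proof.
move=> n0 l0; have nR0 : 0 < n%:R :> R by rewrite ltr0n.
rewrite /dual -addrA lerD2l ler_pdivrMl// mulrDr mulVKf ?gt_eqF//.
set L := l * _; rewrite (_ : n%:R * L = \sum_(i < n) L); last first.
  by rewrite sumr_const card_ord mulr_natl.
rewrite -big_split/=.
apply: ler_sum => i _; apply: le_trans (clipped_gap_lipschitz _ (dotp u (z' - x i)) l0) _.
rewrite lerD2l ler_wpM2l// -dotpBr opprB addrA subrK.
exact: dotp_le_norm.
Qed.

(** Near-maximisers stay in a compact cube. At a cluster point the dual inequality for each fixed
    [u] and [l] follows from the Lipschitz bound in the base point. *)
Lemma max_depth_attained n (n0 : (0 < n)%N) (x : 'I_n -> 'rV[R]_d) delta a :
  0 <= delta -> 0 < a -> max_depth delta (empirical n0 x) = a%:E ->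
  exists z, forall u l, enorm u = 1 -> 0 < l -> a <= dual delta x u z l.
Proof.
move=> delta0 a0 maxE.
(* The floor [a / 2] keeps all levels positive, so that one radius confines the whole sequence. *)
have /choice[z zP] : forall j : nat, exists z, forall u l, enorm u = 1 -> 0 < l ->
    Num.max (a / 2) (a - j.+1%:R^-1) <= dual delta x u z l.
  move=> j; set b := Num.max _ _.
  have : (b%:E < max_depth delta (empirical n0 x))%E.
    rewrite maxE lte_fin gt_max ltrBlDr ltrDl invr_gt0 ltr0n andbT; lra.
  by move=> /ereal_sup_gt[_ [z _ <-]] /ltW /(depth_dualP n0 x _ _ delta0) zP; exists z.
pose M := \sum_(i < n) enorm (x i).
pose r := M + (delta + 1) / (a / 2 - 0%:R / n%:R).
have zr j u : enorm u = 1 -> dotp u (z j) <= r.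
  move=> u1; apply: (level_bounded (J := xpredT) (m := 0) (X := x)) u1 => //.
  - move=> i v _ v1; apply: le_trans (dotp_le_enorm _ v1) _.
    by rewrite /M (bigD1 i)//= lerDl sumr_ge0// => k _; rewrite enorm_ge0.
  - by rewrite leqn0; apply/eqP; apply: eq_card0 => i; rewrite inE.
  - by rewrite mul0r divr_gt0.
  - by move=> v l v1 l0; apply: le_trans (zP j v l v1 l0); rewrite le_max lexx.
have cK : compact [set v : 'rV[R]_d | forall i, v ord0 i \in `[- r, r]].
  apply: (@rV_compact _ _ (fun=> `[- r, r]%classic)) => _.
  exact: segment_compact.
have [|p [_ pz]] := cK (z @ \oo) (fmap_proper_filter _ _).
  exists 0%N => // j _ i /=; rewrite in_itv/= -dotp_delta zr ?enorm_delta// andbT.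
  by rewrite lerNl -dotpNl zr// enormN enorm_delta.
exists p => u l u1 l0; apply/ler_addgt0Pr => e e0.
have e20 : 0 < e / 2 by rewrite divr_gt0.
(* [c] is the Lipschitz constant of the dual; half of [e] pays for the distance to [p], the other
   half for [1 / (j + 1)]. *)
pose c := l * (d%:R * `|u|); have c0 : 0 <= c by rewrite !mulr_ge0// ltW.
have c10 : 0 < c + 1 by rewrite ltr_wpDl.
have rad0 : 0 < e / 2 / (c + 1) by rewrite divr_gt0.
have [||v [/= [j /= jN <-] pv]] := pz
    [set z j | j in [set j | (Num.truncn (e / 2)^-1 <= j)%N]]
    (ball p (e / 2 / (c + 1))).
- by exists (Num.truncn (e / 2)^-1) => // j /= jN; exists j.
- exact: nbhsx_ballx.
have je : j.+1%:R^-1 <= e / 2.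
  rewrite invf_ple ?posrE ?ltr0n//; apply/ltW/(lt_le_trans (truncnS_gt _)).
  by rewrite ler_nat ltnS.
have := zP j u l u1 l0; rewrite ge_max => /andP[_ aj].
have := dual_lipschitz x delta u (z j) p n0 (ltW l0).
move: pv; rewrite -ball_normE/= => pv.
have : l * (d%:R * (`|u| * `|p - z j|)) <= e / 2.
  rewrite (mulrA d%:R) mulrA -/c.
  apply: le_trans (_ : (c + 1) * `|p - z j| <= _); first by rewrite ler_wpM2r// lerDl.
  by rewrite -ler_pdivlMl// mulrC ltW.
move: aj je; set q := j.+1%:R^-1; set D1 := dual _ _ _ _ _; set D2 := dual _ _ _ _ _.
by set L := l * _; lra.
Qed.

(** The default value of [xget] is 0, so a positive [alpha_star] is a genuine solution of its
    equation. *)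
Lemma alpha_starP delta (Q : probability (borelRd R d) R) alpha :
  0 < alpha -> alpha <= alpha_star delta Q ->
  0 < alpha_star delta Q < 1 /\
  max_depth (delta / (1 - alpha_star delta Q)) Q =
    (alpha_star delta Q / (1 - alpha_star delta Q))%:E.
Proof.
move=> a0; rewrite /alpha_star; set S := [set a : R | _].
case: xgetP => [y _ [y01 ->] _ //|_].
by move/(lt_le_trans a0); rewrite ltxx.
Qed.

End max_depth_attained.

Lemma breakdown_point_empirical (R : realType) (d : nat) (d0 : (0 < d)%N)
    (n : nat) (n0 : (0 < n)%N) (x : 'I_n -> 'rV[R]_d) (delta alpha : R) :
  0 <= delta -> 0 < alpha -> alpha <= alpha_star delta (empirical n0 x) ->
  let k : R := (Num.ceil (n%:R * alpha / (1 - alpha)))%:~R in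
  breakdown_point delta alpha n0 x = (k / (n%:R + k))%:E.
Proof.
move=> delta0 a0 aa; have [/andP[as0 as1] maxE] := alpha_starP a0 aa.
set as_ := alpha_star _ _ in aa as0 as1 maxE.
have s0 : 0 < 1 - as_ by rewrite subr_gt0.
have [|z zP] := max_depth_attained _ (divr_gt0 as0 s0) maxE.
  by rewrite divr_ge0// ltW.
(* The maximiser [z] has depth [as_ / (1 - as_)] for the enlarged budget; multiplied by
   [s = 1 - as_] this is [as_], which is at least [alpha]. *)
apply: (@breakdown_pointE R d d0 n n0 x delta alpha (1 - as_) z) => //.
- exact: le_lt_trans aa as1.
- by rewrite lerD2l lerN2.
- move=> u l u1 l0; apply: (le_trans aa).
  by rewrite -ler_pdivrMl// mulrC; exact: zP.
Qed.

(** * Uniform law of large numbers for halfspaces *)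

Section law_of_large_numbers.
Context {R : realType} {dO dV : measure_display} {Omega : measurableType dO}
  {V : measurableType dV}.
Variables (Pr : probability Omega R) (P : probability V R)
  (X : nat -> {mfun Omega >-> V}).
Hypothesis XP : iid Pr P X.
Variables (L : set V) (mL : measurable L).

Let p := fine (P L).

Let PLE : P L = p%:E.
Proof. by rewrite /p fineK// fin_num_measure. Qed.

Let p0 : 0 <= p.
Proof. by rewrite -lee_fin -PLE measure_ge0. Qed.

Let p1 : p <= 1.
Proof. by rewrite -lee_fin -PLE probability_le1. Qed.

Let PLCE : P (~` L) = (1 - p)%:E.
Proof. by rewrite probability_setC// PLE. Qed.

(** Recording hits and misses of [L] reduces the deviation bound to finite sums, since independence
    gives each record a product probability. *)
Definition pattern n (b : {ffun 'I_n -> bool}) : set Omega :=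
  [set w | forall i : 'I_n, b i = (X i w \in L)].

Let pattern_set n (b : {ffun 'I_n -> bool}) (k : nat) : set V :=
  if insub k is Some i then (if b i then L else ~` L) else setT.

Let patternE n (b : {ffun 'I_n -> bool}) :
  pattern b = \bigcap_(i in [set` iota 0 n]) (X i @^-1` pattern_set b i).
Proof.
apply/seteqP; split => w.
  move=> bw i /=; rewrite mem_iota/= add0n => ni.
  rewrite /pattern_set insubT/= bw; case: ifPn; rewrite ?notin_setE ?inE//.
move=> bw i; have /= := bw i; rewrite mem_iota/= add0n => /(_ (ltn_ord i)).
rewrite /pattern_set valK; case: (b i) => XL; apply/esym.
  exact/mem_set.
exact/memNset.
Qed.

Let measurable_pattern_set n (b : {ffun 'I_n -> bool}) k : measurable (pattern_set b k).
Proof.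
rewrite /pattern_set; case: insubP => // i _ _; case: ifP => // _.
exact: measurableC.
Qed.

Lemma measurable_pattern n (b : {ffun 'I_n -> bool}) : measurable (pattern b).
Proof.
rewrite patternE; apply: fin_bigcap_measurable; first exact: finite_seq.
move=> i _; rewrite -[X in measurable X]setTI.
exact: (measurable_funPT (X i)).
Qed.

Lemma pattern_probability n (b : {ffun 'I_n -> bool}) :
  Pr (pattern b) = (\prod_(i < n) if b i then p else 1 - p)%:E.
Proof.
rewrite patternE XP.2 ?iota_uniq//.
rewrite -prodEFin -[n in iota 0 n]subn0 big_mkord; apply: eq_bigr => i _.
rewrite XP.1// /pattern_set valK; case: (b i); [exact: PLE|exact: PLCE].
Qed.

Let bad_pattern (e : R) n (b : {ffun 'I_n -> bool}) :=
  \sum_(i < n) (b i)%:R + n%:R * e <= n%:R * p.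

Let bad (e : R) (n : nat) : set Omega :=
  \big[setU/set0]_(b : {ffun 'I_n -> bool} | bad_pattern e b) pattern b.

Let measurable_bad e n : measurable (bad e n).
Proof. by apply: bigsetU_measurable => b _; exact: measurable_pattern. Qed.

(** Obtained with the exponential tilt [t = e / 2]; being below 1 for [e > 0], it makes the bounds
    summable. *)
Definition chernoff_rate (e : R) : R := expR (- (e / 2) ^+ 2).

(** The tilted moment of one observation, with [e = 2 * t]. It follows from
    [exp(-t) <= 1 / (1 + t) <= 1 - t + t^2] and [1 + y <= exp(y)]. *)
Lemma chernoff_factor_le (t : R) : 0 <= t ->
  p * expR (t * (p - 2 * t) - t) + (1 - p) * expR (t * (p - 2 * t)) <=
  expR (- t ^+ 2).
Proof.
move=> t0.
have -> : p * expR (t * (p - 2 * t) - t) + (1 - p) * expR (t * (p - 2 * t)) =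
    expR (t * (p - 2 * t)) * (1 + p * (expR (- t) - 1)) by rewrite expRD; ring.
have et : expR (- t) <= 1 - t + t ^+ 2.
  rewrite expRN; apply: le_trans (_ : (1 + t)^-1 <= _).
    by rewrite lef_pV2 ?posrE ?expR_gt0 ?expR_ge1Dx//; lra.
  rewrite -[leLHS]mul1r ler_pdivrMr; last lra.
  have -> : (1 - t + t ^+ 2) * (1 + t) = 1 + t ^+ 3 by ring.
  by rewrite lerDl exprn_ge0.
apply: le_trans (_ : expR (t * (p - 2 * t)) * expR (p * (expR (- t) - 1)) <= _).
  by rewrite ler_wpM2l ?expR_ge0// expR_ge1Dx.
rewrite -expRD ler_expR.
have : p * (expR (- t) - 1) <= p * (- t + t ^+ 2) by apply: ler_wpM2l => //; lra.
have : p * t ^+ 2 <= t ^+ 2 by rewrite ler_piMl ?sqr_ge0.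
move: (expR _) => E; lra.
Qed.

(* Chernoff's bound, as a sum over the 2^n possible membership patterns. *)
Lemma bad_probability e n : 0 <= e -> (Pr (bad e n) <= (chernoff_rate e ^+ n)%:E)%E.
Proof.
move=> e0; set t := e / 2; have t0 : 0 <= t by rewrite divr_ge0.
pose q (c : bool) := if c then p else 1 - p.
(* Each hit or miss is weighted by its probability times a tilt; over a bad pattern the tilts
   multiply to at least 1. *)
pose f (c : bool) := q c * expR (t * (p - e) - t * c%:R).
have q0 c : 0 <= q c by rewrite /q; case: c => //; rewrite subr_ge0.
have f0 c : 0 <= f c by rewrite mulr_ge0 ?expR_ge0.
apply: (@le_trans _ _ (\sum_(b : {ffun 'I_n -> bool} | bad_pattern e b) \prod_(i < n) f (b i))%:E).
  rewrite -sumEFin /bad.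
  have [] // : measurable (\big[setU/set0]_(b : {ffun 'I_n -> bool} | bad_pattern e b) pattern b) /\
    (Pr (\big[setU/set0]_(b : {ffun 'I_n -> bool} | bad_pattern e b) pattern b) <=
    \sum_(b : {ffun 'I_n -> bool} | bad_pattern e b) (\prod_(i < n) f (b i))%:E)%E.
  apply: (big_ind2 (fun A (r : \bar R) => measurable A /\ (Pr A <= r)%E)).
  - by split; [exact: measurable0|rewrite measure0].
  - move=> A r B r' [mA Ar] [mB Br']; split; first exact: measurableU.
    by apply: le_trans (measureU2 _ mA mB) _; exact: leeD.
  - move=> b bb; split; first exact: measurable_pattern.
    rewrite pattern_probability lee_fin big_split/= -[leLHS]mulr1.
    rewrite ler_wpM2l //; first by apply: prodr_ge0 => i _; exact: q0.
    rewrite -expR_sum -[leLHS]expR0 ler_expR.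
    rewrite sumrB sumr_const card_ord -mulr_sumr -[_ *+ n]mulr_natl.
    move: bb; rewrite /bad_pattern; set s := \sum_(i < n) _ => bb.
    have -> : n%:R * (t * (p - e)) - t * s = t * (n%:R * p - (s + n%:R * e)) by ring.
    by rewrite mulr_ge0// subr_ge0.
rewrite lee_fin.
apply: (@le_trans _ _ (\sum_(b : {ffun 'I_n -> bool}) \prod_(i < n) f (b i))).
  by rewrite [leRHS](bigID (fun b => bad_pattern e b))/= lerDl sumr_ge0// => b _; exact: prodr_ge0.
(* The sum over all patterns factors into the [n]-th power of the one-observation moment. *)
rewrite -(bigA_distr_bigA (fun _ : 'I_n => f)) prodr_const card_ord big_bool/=.
rewrite lerXn2r ?nnegrE ?addr_ge0 ?expR_ge0//.
have eE : e = 2 * t by rewrite /t mulrC divfK.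
rewrite /chernoff_rate -/t /f /q mulr1 mulr0 subr0 [in leLHS]eE.
exact: chernoff_factor_le.
Qed.

(** Borel-Cantelli: the deviation probabilities are dominated by a geometric series, so almost
    surely only finitely many [n] are bad. *)
Lemma empirical_frequency_lower e : 0 < e ->
  {ae Pr, forall w, exists N, forall n, (N <= n)%N ->
     n%:R * fine (P L) <= \sum_(i < n) \1_L (X i w) + n%:R * e}.
Proof.
move=> e0; exists (lim_sup_set (bad e)); split.
- apply: bigcap_measurable => // k _; apply: bigcup_measurable => j _.
  exact: measurable_bad.
- apply: lim_sup_set_cvg0 => //.
  have r0 : 0 < chernoff_rate e by exact: expR_gt0.
  have r1 : chernoff_rate e < 1.
    by rewrite -[ltRHS]expR0 ltr_expR oppr_lt0 exprn_gt0// divr_gt0.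
  apply: le_lt_trans (ltry (1 / (1 - chernoff_rate e))).
  apply: lime_le; first exact: is_cvg_nneseries.
  apply: nearW => n.
  apply: (@le_trans _ _ (\sum_(0 <= i < n) (chernoff_rate e ^+ i)%:E)%E).
    by apply: lee_sum => i _; exact: bad_probability (ltW e0).
  rewrite sumEFin lee_fin.
  have := @geometric_le_lim R n 1 (chernoff_rate e) ler01 r0.
  rewrite gtr0_norm// => /(_ r1); apply: le_trans.
  by rewrite /series/=; apply: ler_sum => i _; rewrite /geometric/= mul1r.
- move=> w /= Nw N _; apply: contrapT => badN; apply: Nw; exists N => n Nn.
  rewrite leNgt; apply/negP => wn; apply: badN; exists n => //.
  pose b := [ffun i : 'I_n => X i w \in L].
  have bE : \sum_(i < n) \1_L (X i w) = \sum_(i < n) (b i)%:R :> R.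
    by apply: eq_bigr => i _; rewrite indicE ffunE.
  rewrite /bad (bigD1 b)/=; first by left => i; rewrite ffunE.
  by rewrite /bad_pattern -bE ltW.
Qed.

End law_of_large_numbers.

(** Finitely many interiors of the local sets cover [K]; points outside [K] are assigned the empty
    set. *)
Lemma compact_local (T : ptopologicalType) (K : set T) (P : set T -> Prop) :
  compact K -> P set0 -> (forall A B, P A -> P B -> P (A `|` B)) ->
  (forall A B, A `<=` B -> P B -> P A) ->
  (forall x, K x -> exists2 U, nbhs x U & P U) -> P K.
Proof.
move=> cK P0 PU PS locP.
have /choice[f fP] : forall x, exists U : set T, open U /\ P U /\ (K x -> U x).
  move=> x; have [Kx|nKx] := pselect (K x); last by exists set0; split; [exact: open0|].
  have [U xU PU'] := locP x Kx; exists U°; split; first exact: open_interior.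
  split; last by [].
  by apply: PS PU'; exact: interior_subset.
have : cover_compact K by rewrite -compact_cover.
move=> /(_ T setT f) [|x Kx|D _ KD].
- by move=> x _; have [] := fP x.
- by exists x => //; have [_ [_]] := fP x; exact.
apply: PS KD _; rewrite /cover bigcup_fset.
apply: (big_ind P) => // x _.
by have [_ []] := fP x.
Qed.

(** * Finite inner brackets for linear sets *)

Section brackets.
Context {R : realType} {dV : measure_display} {V : measurableType dV}.
Variable P : probability V R.

(** The induction on the dimension needs a general feature map [T] and a general domain [A]: it
    restricts [A] to a hyperplane and drops a coordinate of [T]. *)
Definition linear_set k (T : V -> 'rV[R]_k) (A : set V) (v : 'rV[R]_k) : set V :=
  [set x | A x /\ 0 <= dotp v (T x)].

Definition inner_brackets k (T : V -> 'rV[R]_k) (A : set V) (e : R)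
    (B : set 'rV[R]_k) :=
  exists s : seq (set V), (forall L, L \in s -> measurable L) /\
    forall v, B v -> exists L, [/\ L \in s, L `<=` linear_set T A v &
      (P (linear_set T A v `\` L) <= e%:E)%E].

Lemma measurable_linear_set k (T : V -> 'rV[R]_k) A v : measurable A ->
  (forall i, measurable_fun setT (fun x => T x 0 i)) ->
  measurable (linear_set T A v).
Proof.
move=> mA mT.
have := measurable_dotp v mT measurableT (measurable_itv `[0, +oo[).
rewrite setTI => mS; rewrite [X in measurable X](_ : _ = A `&` (fun x => dotp v (T x)) @^-1` `[0, +oo[).
  exact: measurableI.
by apply/seteqP; split => x; rewrite /linear_set/= in_itv/= andbT.
Qed.

Lemma inner_brackets1 k (T : V -> 'rV[R]_k) A e (B : set 'rV[R]_k) :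
  measurable A -> 0 <= e -> (forall v, B v -> linear_set T A v = A) ->
  inner_brackets T A e B.
Proof.
move=> mA e0 BA; exists [:: A]; split=> [L|v /BA ->]; first by rewrite inE => /eqP ->.
by exists A; split; rewrite ?inE// setDv measure0.
Qed.

Lemma dotp_le_norm1 k (u x : 'rV[R]_k) :
  `|dotp u x| <= `|u| * \sum_(i < k) `|x 0 i|.
Proof.
apply: le_trans (ler_norm_sum _ _ _) _; rewrite mulr_sumr; apply: ler_sum => i _.
by rewrite normrM ler_wpM2r// coord_le_norm.
Qed.

(** On the hyperplane orthogonal to [v0], subtracting a multiple of [v0] from [v] changes nothing;
    the multiple is chosen to cancel coordinate [i]. *)
Lemma dotp_hyperplane k (v0 v y : 'rV[R]_k.+1) (i : 'I_k.+1) : v0 0 i != 0 ->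
  dotp v0 y = 0 ->
  dotp v y = dotp (col' i (v - (v 0 i / v0 0 i) *: v0)) (col' i y).
Proof.
move=> v0i v0y; set c := v 0 i / v0 0 i.
have -> : dotp v y = dotp (v - c *: v0) y by rewrite dotpBl dotpZl v0y mulr0 subr0.
rewrite /dotp (bigD1_ord i)//= !mxE divfK// subrr mul0r add0r.
by apply: eq_bigr => j _; rewrite !mxE.
Qed.

(** The slabs shrink to the empty set as [r] tends to 0, so continuity from above applies. The
    strict [0 < |g x|] matters: the set [g = 0] may carry mass. *)
Lemma slab_small (A : set V) (g h : V -> R) (e : R) : measurable A ->
  measurable_fun setT g -> measurable_fun setT h -> 0 < e ->
  exists2 r, 0 < r &
    measurable [set x | A x /\ 0 < `|g x| <= r * h x] /\
    (P [set x | A x /\ (0 < `|g x| <= r * h x)%R] <= e%:E)%E.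
Proof.
move=> mA mg mh e0.
pose F (j : nat) := [set x | A x /\ 0 < `|g x| <= j.+1%:R^-1 * h x].
have mF j : measurable (F j).
  have mgh : measurable_fun setT (fun x => j.+1%:R^-1 * h x - `|g x|).
    by apply: measurable_funB; [exact: measurable_funM|exact: measurableT_comp].
  have := mgh measurableT _ (measurable_itv `[0, +oo[); rewrite setTI => m1.
  have := mg measurableT _ (measurableC (measurable_set1 0)); rewrite setTI => m2.
  have := measurableI _ _ mA (measurableI _ _ m2 m1); congr measurable.
  apply/seteqP; split => x; rewrite /F/= in_itv/= andbT subr_ge0 normr_gt0.
    by move=> [Ax [/eqP gx hx]]; rewrite gx hx.
  by move=> [Ax /andP[/eqP gx hx]].
have F0 : \bigcap_j F j = set0.
  apply/seteqP; split => // x Fx.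
  have [Ax /andP[gx gh]] := Fx 0%N I.
  have h0 : 0 < h x by move: gh; rewrite invr1 mul1r; exact: lt_le_trans.
  have [_ /andP[_]] := Fx (Num.truncn (h x / `|g x|)) I.
  rewrite ler_pdivlMl ?ltr0n// -ler_pdivlMr// leNgt => /negP; apply.
  exact: truncnS_gt.
have niF : nonincreasing_seq F.
  move=> i j ij; apply/subsetPset => x [Ax /andP[gx gh]]; split => //; rewrite gx/=.
  have h0 : 0 < h x.
    by have := lt_le_trans gx gh; rewrite pmulr_rgt0 ?invr_gt0 ?ltr0n.
  apply: (le_trans gh); rewrite ler_pM2r// lef_pV2 ?posrE ?ltr0n//.
  by rewrite ler_nat ltnS.
have := nonincreasing_cvg_mu (mu := P) (F := F).
rewrite F0 measure0 => /(_ _ mF measurable0 niF) PF.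
have {}PF : P (F j) @[j --> \oo] --> 0%E.
  by apply: PF; rewrite (le_lt_trans (probability_le1 P (mF 0%N)))// ltry.
have [N _ /(_ N (leqnn N)) /= PN] := cvgr_lt _ (fine_cvg PF) _ e0.
exists N.+1%:R^-1; [by rewrite invr_gt0 ltr0n|split; first exact: mF].
by rewrite -[leLHS]fineK ?fin_num_measure// ?lee_fin ?ltW//; exact: mF.
Qed.

(** For [v] within [r] of [v0], the forms differ by at most [r * h]. Hence all points of [good]
    satisfy the inequality for [v], the slab costs at most [e / 2], and the hyperplane [g = 0] is
    bracketed in one dimension less with error [e / 2]. *)
Lemma brackets_step k (T : V -> 'rV[R]_k.+1) A e (v0 : 'rV[R]_k.+1) :
  (forall (T' : V -> 'rV[R]_k) A' e', measurable A' ->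
    (forall i, measurable_fun setT (fun x => T' x 0 i)) -> 0 < e' ->
    inner_brackets T' A' e' setT) ->
  measurable A -> (forall i, measurable_fun setT (fun x => T x 0 i)) -> 0 < e ->
  v0 != 0 -> exists2 U, nbhs v0 U & inner_brackets T A e U.
Proof.
move=> IH mA mT e0 v00.
have [i v0i] : exists i, v0 0 i != 0.
  apply: contrapT => /forallNP nv0; move/eqP: v00; apply; apply/rowP => i.
  by rewrite mxE; apply/eqP; apply: contrapT => /negP; exact: nv0.
pose g x := dotp v0 (T x); pose h x := \sum_(j < k.+1) `|T x 0 j|.
have mg : measurable_fun setT g by exact: measurable_dotp.
have mh : measurable_fun setT h.
  by apply: measurable_sum => j; exact: measurableT_comp.
have e20 : 0 < e / 2 by rewrite divr_gt0.
have [r r0 [mbad Pbad]] := slab_small mA mg mh e20.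
set bad := [set x | _] in mbad Pbad.
pose A' := A `&` g @^-1` [set 0].
have mA' : measurable A'.
  by apply: measurableI => //; rewrite -[X in measurable X]setTI; exact: mg.
pose T' x := col' i (T x).
have mT' j : measurable_fun setT (fun x => T' x 0 j).
  by under eq_fun do rewrite mxE; exact: mT.
have [s [ms sP]] := IH T' A' (e / 2) mA' mT' e20.
pose good := A `&` [set x | r * h x < g x].
have mgood : measurable good.
  apply: measurableI => //.
  have : measurable_fun setT (fun x => g x - r * h x).
    by apply: measurable_funB => //; exact: measurable_funM.
  move=> /(_ measurableT _ (measurable_itv `]0, +oo[)); rewrite setTI.
  by congr measurable; apply/seteqP; split => x; rewrite /= in_itv/= andbT subr_gt0.
exists (ball v0 r); first exact: nbhsx_ballx.
exists [seq L `|` good | L <- s]; split=> [_ /mapP[L sL ->]|v].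
  by apply: measurableU => //; exact: ms.
rewrite -ball_normE/= => v0v.
pose v' := col' i (v - (v 0 i / v0 0 i) *: v0).
have vE x : g x = 0 -> dotp v (T x) = dotp v' (T' x) by move=> ?; exact: dotp_hyperplane.
have near x : `|g x - dotp v (T x)| <= r * h x.
  rewrite /g -dotpBl; apply: le_trans (dotp_le_norm1 _ _) _.
  by rewrite ler_wpM2r ?sumr_ge0// ltW.
have [L [sL LS PL]] := sP v' I.
exists (L `|` good); split.
- by apply/mapP; exists L.
- move=> x [/LS[[Ax gx] vx]|[Ax /= gx]]; split => //; first by rewrite vE.
  by have := near x; rewrite ler_norml => /andP[_]; lra.
have mS' := measurable_linear_set v' mA' mT'.
have mL := ms _ sL.
apply: (@le_trans _ _ (P (bad `|` (linear_set T' A' v' `\` L)))).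
  apply: le_measure; rewrite ?inE.
  - apply: measurableD; first exact: measurable_linear_set.
    exact: measurableU.
  - by apply: measurableU => //; exact: measurableD.
  (* A missed point with [g x] nonzero lies in the slab: [g x > r * h x] would put it in [good], and
     [g x < - r * h x] would make [dotp v (T x)] negative. *)
  move=> x [[Ax vx] /not_orP[nL ngood]].
  have [gx0|gx0] := eqVneq (g x) 0.
    by right; split => //; split; [split|rewrite -vE].
  left; split=> //; rewrite normr_gt0 gx0/= leNgt; apply/negP => gh.
  apply: ngood; split => //=; have := near x; rewrite ler_norml => /andP[gv _].
  by move: gh; have [g0|g0] := leP 0 (g x); [rewrite ger0_norm|rewrite ltr0_norm//; lra].
apply: le_trans (measureU2 _ mbad (measurableD mS' mL)) _.
by rewrite [e]splitr EFinD leeD.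
Qed.

(** Local brackets are patched over the compact unit sphere; scaling reaches every nonzero [v], and
    the extra bracket [A] serves [v = 0]. *)
Lemma brackets k (T : V -> 'rV[R]_k) A e : measurable A ->
  (forall i, measurable_fun setT (fun x => T x 0 i)) -> 0 < e ->
  inner_brackets T A e setT.
Proof.
elim: k T A e => [|k IH] T A e mA mT e0.
  apply: inner_brackets1 => //; first exact: ltW.
  by move=> v _; apply/seteqP; split=> [x []//|x Ax]; split; rewrite // /dotp big_ord0.
pose S := [set v : 'rV[R]_k.+1 | `|v| = 1].
have cS : compact S.
  apply: bounded_closed_compact.
    by exists 1; split=> [|M M1 v /= ->]; [exact: num_real|exact: ltW].
  rewrite (_ : S = Num.norm @^-1` [set 1])//; apply: closed_comp => //.
  by move=> v _; exact: norm_continuous.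
have [s [ms sP]] : inner_brackets T A e S.
  apply: (compact_local cS).
  - by exists [::]; split.
  - move=> B C [sB [mB BP]] [sC [mC CP]]; exists (sB ++ sC); split.
      by move=> L; rewrite mem_cat => /orP[/mB|/mC].
    by move=> v [/BP|/CP] [L [sL ? ?]]; exists L; split => //; rewrite mem_cat sL ?orbT.
  - by move=> B C BC [s [ms sP]]; exists s; split => // v /BC /sP.
  - move=> v /= v1; apply: brackets_step => //.
    by rewrite -normr_eq0 v1 oner_eq0.
have linear_set0 : linear_set T A 0 = A.
  apply/seteqP; split=> x; first by case.
  by split => //; rewrite /dotp big1// => i _; rewrite mxE mul0r.
exists (A :: s); split=> [L|v _]; first by rewrite inE => /orP[/eqP ->//|/ms].
have [->|v0] := eqVneq v 0.
  by exists A; rewrite linear_set0; split; rewrite ?inE ?eqxx// setDv measure0 lee_fin ltW.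
have nv0 : 0 < `|v| by rewrite normr_gt0.
have [|L [sL LS PL]] := sP (`|v|^-1 *: v).
  by rewrite /S/= normrZ normfV normr_id mulVf ?gt_eqF.
have E : linear_set T A (`|v|^-1 *: v) = linear_set T A v.
  apply/seteqP; split => x [Ax]; rewrite /linear_set/= dotpZl;
    by rewrite pmulr_rge0 ?invr_gt0.
by exists L; rewrite -E; split => //; rewrite inE sL orbT.
Qed.

End brackets.

(** * From linear sets to affine halfspaces *)

Section uniform_halfspaces.
Context {R : realType} {d : nat} {dO : measure_display} {Omega : measurableType dO}.
Local Notation V := (borelRd R d).
Variables (Pr : probability Omega R) (P : probability V R)
  (X : nat -> {mfun Omega >-> V}).
Hypothesis XP : iid Pr P X.

(* Affine halfspaces of R^d become linear ones on R^(1+d). *)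
Definition homogenize (x : 'rV[R]_d) : 'rV[R]_(1 + d) := row_mx (const_mx 1) x.

Lemma halfspaceE (u z : 'rV[R]_d) :
  halfspace u z = linear_set (homogenize : V -> _) setT
    (row_mx (const_mx (- dotp u z)) u).
Proof.
have E x : dotp (row_mx (const_mx (- dotp u z)) u) (homogenize x) = dotp u (x - z).
  rewrite dotpBr [LHS]/dotp big_split_ord big_ord1/= !row_mxEl !mxE mulr1 addrC.
  by congr (_ - _); apply: eq_bigr => i _; rewrite !row_mxEr.
by apply/seteqP; split => x; rewrite /halfspace /linear_set/= E => // -[].
Qed.

Lemma measurable_homogenize i :
  measurable_fun [set: V] (fun x : V => homogenize x 0 i).
Proof.
case: (split_ordP i) => j ->.
  under eq_fun do rewrite row_mxEl mxE.
  exact: measurable_cst.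
under eq_fun do rewrite row_mxEr.
exact: measurable_coord.
Qed.

Lemma empirical_frequencies_lower (s : seq (set V)) e :
  (forall L, L \in s -> measurable L) -> 0 < e ->
  {ae Pr, forall w, exists N, forall n, (N <= n)%N -> forall L, L \in s ->
     n%:R * fine (P L) <= \sum_(i < n) \1_L (X i w) + n%:R * e}.
Proof.
move=> + e0; elim: s => [_|L s IH ms]; first by apply: aeW => w; exists 0%N.
have mL : measurable L by apply: ms; rewrite mem_head.
have {}IH := IH (fun L' sL' => ms L' (mem_behead (s := L :: s) sL')).
apply: filterS2 (empirical_frequency_lower XP mL e0) IH => w [N1 N1P] [N2 N2P].
exists (maxn N1 N2) => n; rewrite geq_max => /andP[N1n N2n] L'.
by rewrite inE => /orP[/eqP ->|]; [exact: N1P|exact: N2P].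
Qed.

(** With [L] an inner bracket of [H], [P H <= P L + e/2 <= P_n L + e <= P_n H + e]. Finitely many
    brackets make [N] independent of [u] and [z]. *)
Lemma empirical_halfspaces_lower e : 0 < e ->
  {ae Pr, forall w, exists N, forall n, (N <= n)%N ->
     forall u z, (P (halfspace u z) <=
       empirical (ltn0Sn n) (fun i : 'I_n.+1 => X i w) (halfspace u z) + e%:E)%E}.
Proof.
move=> e0; have e20 : 0 < e / 2 by rewrite divr_gt0.
have [s [ms sP]] := brackets P measurableT measurable_homogenize e20.
apply: filterS (empirical_frequencies_lower ms e20) => w [N NP].
exists N => n Nn u z; set H : set V := halfspace u z.
have [L [sL LH PHL]] := sP (row_mx (const_mx (- dotp u z)) u) I.
rewrite -halfspaceE -[halfspace u z]/H in LH PHL.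
have mL := ms _ sL; have mH : measurable H by exact: measurable_halfspace.
have PH : (P H <= P L + (e / 2)%:E)%E.
  rewrite -(setDUK LH); apply: le_trans (measureU2 _ mL (measurableD mH mL)) _.
  exact: leeD2l.
apply: (le_trans PH); rewrite empiricalE -[P L]fineK ?fin_num_measure//.
rewrite -!EFinD lee_fin [e in leRHS]splitr addrA lerD2r.
have n0 : 0 < n.+1%:R :> R by rewrite ltr0n.
have := NP n.+1 (leqW Nn) L sL; rewrite -ler_pdivlMl// mulrDr mulKf ?gt_eqF//.
move=> /le_trans; apply; rewrite lerD2r ler_pM2l ?invr_gt0//.
apply: ler_sum => i _; rewrite !indicE ler_nat.
by case: (boolP (X i w \in L)) => // /set_mem/LH/mem_set ->.
Qed.

End uniform_halfspaces.

(** * Empirical laws of an i.i.d. sequence *)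

(** Since [q <= k < q + 1], the ratio lies between [alpha] and [alpha + 1 / (n + 1)]. *)
Lemma ceil_ratio_cvg (R : realType) (alpha : R) : 0 < alpha -> alpha < 1 ->
  (let k : R := (Num.ceil (n.+1%:R * alpha / (1 - alpha)))%:~R in
   k / (n.+1%:R + k)) @[n --> \oo] --> alpha.
Proof.
move=> a0 a1 /=; apply: (@squeeze_cvgr _ _ _ _ (fun=> alpha)
    (fun n : nat => alpha + n.+1%:R^-1)); last 2 first.
- exact: cvg_cst.
- rewrite -[X in _ --> X]addr0; apply: cvgD; first exact: cvg_cst.
  exact: cvg_harmonic.
have a10 : 0 < 1 - alpha by lra.
apply: nearW => n; set N : R := n.+1%:R; set q := N * alpha / (1 - alpha).
have N1 : 1 <= N by rewrite ler1n.
have N0 : 0 < N by lra.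
have q0 : 0 < q by rewrite divr_gt0// mulr_gt0.
set k := (Num.ceil q)%:~R.
have qk : q <= k by exact: ceil_ge.
have kq : k < q + 1 by rewrite -ltrBlDr; have := ceilB1_lt q; rewrite intrB.
have Nk0 : 0 < N + k by lra.
have : N * alpha <= k * (1 - alpha) by rewrite -ler_pdivrMr.
have : k * (1 - alpha) <= N * alpha + (1 - alpha).
  have <- : q * (1 - alpha) = N * alpha by rewrite divfK// gt_eqF.
  by rewrite -{3}[1 - alpha]mul1r -mulrDl ler_pM2r// ltW.
rewrite ler_pdivlMr// ler_pdivrMr// => ka1 ka2; apply/andP; split; first lra.
rewrite [leRHS]mulrDl.
have : 1 <= N^-1 * (N + k) by rewrite ler_pdivlMl// mulr1; lra.
by move: (N^-1 * _) => W; lra.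
Qed.

Lemma breakdown_point_iid (R : realType) (d : nat) (d0 : (0 < d)%N)
    (dO : measure_display) (Omega : measurableType dO)
    (Pr : probability Omega R) (P : probability (borelRd R d) R)
    (X : nat -> {mfun Omega >-> borelRd R d}) (delta alpha : R) :
  iid Pr P X -> 0 <= delta -> 0 < alpha -> alpha < alpha_star delta P ->
  {ae Pr, forall w,
     breakdown_point delta alpha (ltn0Sn n) (fun i : 'I_n.+1 => X i w)
       @[n --> \oo] --> alpha%:E}.
Proof.
move=> XP delta0 a0 aa; have [/andP[as0 as1] maxE] := alpha_starP a0 (ltW aa).
set as_ := alpha_star _ _ in aa as0 as1 maxE.
have s0 : 0 < 1 - as_ by rewrite subr_gt0.
(* The strict inequality leaves room: [z] is deep for [P] at the midpoint level [a'], and [e] below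
   is exactly what may be lost in passing to the sample while keeping [alpha / (1 - as_)]. *)
pose a' := (alpha + as_) / 2.
have : ((a' / (1 - as_))%:E < max_depth (delta / (1 - as_)) P)%E.
  by rewrite maxE lte_fin ltr_pM2r ?invr_gt0// /a'; lra.
move=> /ereal_sup_gt[_ [z _ <-]] /ltW az.
pose e := (a' - alpha) / (1 - as_).
have e0 : 0 < e by rewrite divr_gt0// /a'; lra.
apply: filterS (empirical_halfspaces_lower XP e0) => w [N NP].
have a1 : alpha < 1 by exact: lt_trans aa as1.
(* The same [z] serves every [n] from [N] on, so the exact formula holds eventually and the limit is
   that of the ceiling ratio. *)
have BPE n : (N <= n)%N ->
    breakdown_point delta alpha (ltn0Sn n) (fun i : 'I_n.+1 => X i w) =
    let k : R := (Num.ceil (n.+1%:R * alpha / (1 - alpha)))%:~R in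
    (k / (n.+1%:R + k))%:E.
  move=> Nn; apply: (@breakdown_pointE R d d0 _ _ _ _ _ (1 - as_) z) => //.
    by rewrite lerD2l lerN2 ltW.
  move=> u l u1 l0; rewrite -ler_pdivrMl// mulrC.
  have -> : alpha / (1 - as_) = a' / (1 - as_) - e by rewrite /e -mulrBl; congr (_ / _); ring.
  exact: depth_le_dual (fun u z' _ => NP n Nn u z') az _ _ u1 l0.
apply: cvg_EFin; first by exists N => // n /= /BPE ->.
apply: cvg_trans (ceil_ratio_cvg a0 a1); apply: near_eq_cvg.
by exists N => // n /= /BPE ->.
Qed.

Theorem proposition6 (R : realType) (d : nat) (d0 : (0 < d)%N) :
  (forall (n : nat) (n0 : (0 < n)%N) (x : 'I_n -> 'rV[R]_d) (delta alpha : R),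
     0 <= delta -> 0 < alpha -> alpha <= alpha_star delta (empirical n0 x) ->
     let k : R := (Num.ceil (n%:R * alpha / (1 - alpha)))%:~R in
     breakdown_point delta alpha n0 x = (k / (n%:R + k))%:E) /\
  (forall (dO : measure_display) (Omega : measurableType dO)
     (Pr : probability Omega R) (P : probability (borelRd R d) R)
     (X : nat -> {mfun Omega >-> borelRd R d}) (delta alpha : R),
     iid Pr P X ->
     0 <= delta -> 0 < alpha -> alpha < alpha_star delta P ->
     {ae Pr, forall w,
        breakdown_point delta alpha (ltn0Sn n) (fun i : 'I_n.+1 => X i w)
          @[n --> \oo] --> alpha%:E}).
Proof.
split.
- exact: breakdown_point_empirical.
- exact: breakdown_point_iid.
Qed.
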